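(* Let $f\in\mathscr{B}^p_{c,T}$, where $1\le p\le+\infty$, $c\in\mathbb{R}$ and $T>0$. Then $$\bigl(\widetilde{\Theta}_cf\bigr)(r,\theta)=\frac{4T}{\pi^2}\sum_{k\in\mathbb{Z}}\frac{(-1)^k}{(2k+1)^2}\,e^{(k+1/2)\pi c/T}\,f\bigl(re^{(k+1/2)\pi/T},\theta\bigr)$$ for $(r,\theta)\in\mathbb{H}$. Multiplied by $r^c$, the series converges absolutely and uniformly on strips of bounded width parallel to the $r$-axis in $\mathbb{H}$ (that is, on sets $\{(r,\theta)\in\mathbb{H}: a\le\theta\le b\}$ with $a<b$ real).
   Context: $\mathbb{H}:=\{(r,\theta): r\in\mathbb{R}^+,\ \theta\in\mathbb{R}\}$ with $\mathbb{R}^+=(0,\infty)$. A function $f:\mathbb{H}\to\mathbb{C}$ is polar-analytic on $\mathbb{H}$ if for every $(r_0,\theta_0)\in\mathbb{H}$ the limit $$(D_{\rm pol}f)(r_0,\theta_0):=\lim_{(r,\theta)\to(r_0,\theta_0)}\frac{f(r,\theta)-f(r_0,\theta_0)}{re^{i\theta}-r_0e^{i\theta_0}}$$ exists. The polar Mellin derivative is $(\widetilde{\Theta}_cf)(r,\theta):=re^{i\theta}(D_{\rm pol}f)(r,\theta)+c f(r,\theta)$. For $c\in\mathbb{R}$ and $1\le p<\infty$, $X_c^p$ is the space of measurable $\varphi:\mathbb{R}^+\to\mathbb{C}$ with $\|\varphi\|_{X_c^p}:=\bigl(\int_0^\infty r^{cp}|\varphi(r)|^p\frac{dr}{r}\bigr)^{1/p}<\infty$;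 $X_c^\infty$ is the space of measurable $\varphi$ with $\|\varphi\|_{X_c^\infty}:=\sup_{r>0}r^c|\varphi(r)|<\infty$. The Mellin--Bernstein space $\mathscr{B}^p_{c,T}$ ($T>0$) consists of all $f:\mathbb{H}\to\mathbb{C}$ such that (i) $f$ is polar-analytic on $\mathbb{H}$; (ii) $f(\cdot,0)\in X_c^p$; (iii) there is a constant $C_f>0$ with $r^c|f(r,\theta)|\le C_fe^{T|\theta|}$ for all $(r,\theta)\in\mathbb{H}$. *)

(* Defs.v *)
From HB Require Import structures.
From mathcomp Require Import all_boot all_order all_algebra.
From mathcomp Require Import all_classical all_reals all_analysis.
From mathcomp Require Import complex.

Set Implicit Arguments.
Unset Strict Implicit.
Unset Printing Implicit Defensive.

Import Order.TTheory GRing.Theory Num.Theory numFieldNormedType.Exports.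
Import ComplexField.Normc.

Local Open Scope classical_set_scope.
Local Open Scope ring_scope.
Local Open Scope complex_scope.

(* [R[i]] is already a [numClosedFieldType]; this gives it the topology and
   uniform structure of its modulus, which are not inferred from that
   structure because the carrier is headed by [complex]. *)
HB.instance Definition _ (R : rcfType) :=
  NormedModule.copy R[i] R[i]^o.

(* The half-plane of polar coordinates; functions on it are represented by
   total functions on R * R, whose values off [polarH] are never used. *)
Definition polarH (R : realType) : set (R * R) := [set x | 0 < x.1].

Definition polar (R : realType) (x : R * R) : R[i] :=
  x.1%:C * (cos x.2 +i* sin x.2).

Definition polar_quotient (R : realType) (f : R * R -> R[i]) (x0 x : R * R) :
    R[i] :=
  (f x - f x0) / (polar x - polar x0).

(* Since [polarH] is open, punctured neighborhoods in R * R of one of its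
   points may be used; [polar] is locally injective there, so the denominator
   of the quotient is eventually nonzero. *)
Definition polar_analytic (R : realType) (f : R * R -> R[i]) : Prop :=
  forall x0, polarH x0 -> cvg (polar_quotient f x0 x @[x --> x0^']).

Definition Dpol (R : realType) (f : R * R -> R[i]) (x0 : R * R) : R[i] :=
  lim (polar_quotient f x0 x @[x --> x0^']).

Definition polar_Mellin_derivative (R : realType) (c : R)
    (f : R * R -> R[i]) (x : R * R) : R[i] :=
  polar x * Dpol f x + c%:C * f x.

(* The second branch is the supremum norm, for p = +oo; p = -oo is excluded
   by the hypothesis 1 <= p wherever this is used. *)
Definition Xnorm (R : realType) (c : R) (p : \bar R) (phi : R -> R[i]) :
    \bar R :=
  match p with
  | q%:E => ((\int[lebesgue_measure]_(r in `]0%R, +oo[)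
               (r `^ (c * q) * normc (phi r) `^ q / r)%:E) `^ q^-1)%E
  | _ => ereal_sup [set (r `^ c * normc (phi r))%:E | r in `]0, +oo[]
  end.

Definition Xspace (R : realType) (c : R) (p : \bar R) (phi : R -> R[i]) :
    Prop :=
  [/\ measurable_fun (`]0, +oo[ : set R) (fun r => complex.Re (phi r)),
      measurable_fun (`]0, +oo[ : set R) (fun r => complex.Im (phi r)) &
      (Xnorm c p phi < +oo)%E].

Definition Mellin_Bernstein (R : realType) (p : \bar R) (c T : R)
    (f : R * R -> R[i]) : Prop :=
  [/\ polar_analytic f,
      Xspace c p (fun r => f (r, 0)) &
      exists2 Cf : R, 0 < Cf &
        forall r theta, polarH (r, theta) ->
          r `^ c * normc (f (r, theta)) <= Cf * expR (T * `|theta|)].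

(* For N = (m, n), the sum of t k over the integers -m <= k < n. *)
Definition zpartial (V : nmodType) (t : int -> V) (N : nat * nat) : V :=
  \sum_(0 <= k < N.1) t (- (k.+1)%:Z) + \sum_(0 <= k < N.2) t k%:Z.

(* Both ends of the range tend to infinity independently. *)
Definition zsum (R : realType) (t : int -> R[i]) : R[i] :=
  lim (zpartial t N @[N --> filter_prod \oo \oo]).

Definition boas_term (R : realType) (c T : R) (f : R * R -> R[i])
    (x : R * R) (k : int) : R[i] :=
  ((-1) ^ k / (2 * k%:~R + 1) ^+ 2
     * expR ((k%:~R + 2^-1) * pi * c / T))%:C
  * f (x.1 * expR ((k%:~R + 2^-1) * pi / T), x.2).

Definition strip (R : realType) (a b : R) : set (R * R) :=
  [set x | polarH x /\ a <= x.2 <= b].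

(* Main.v *)
(** In the variable [z = log r + i theta], [F z = e^(c z) f(e^(Re z), Im z)] is
    complex differentiable on the whole plane, [|F z| <= C e^(T |Im z|)] and
    [F' = e^(c z) (Theta_c f)], so that the formula is the interpolation formula
    of Boas for the derivative of an entire function of exponential type.  After
    an affine change of variable (type [pi / 2], point [0]) it is obtained by
    integrating [(F w / cos (pi w / 2) - F 0) / w ^ 2] over the boundary of the
    square of half-side [2n + 1/2]: the integrand is [O(n^-2)] there, and its
    poles, [0] and the odd integers, are simple, with residue [F' 0] at [0].
    Since [F] is only assumed to be differentiable, Cauchy's theorem is proved
    for rectangles by Goursat's bisection. *)

Require Import Defs.
From mathcomp Require Import all_boot all_order all_algebra.
From mathcomp Require Import all_classical all_reals all_analysis.
From mathcomp Require Import complex.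
From mathcomp Require Import ring lra.
Import Order.TTheory GRing.Theory Num.Theory numFieldNormedType.Exports.
Import ComplexField.Normc.
Local Open Scope classical_set_scope.
Local Open Scope ring_scope.
Local Open Scope complex_scope.
Local Notation Re := (@complex.Re _).
Local Notation Im := (@complex.Im _).

Set Implicit Arguments.
Unset Strict Implicit.
Unset Printing Implicit Defensive.

(** The kernel is chosen so that first-order information at its poles suffices. Dividing by the
    cosine compensates the growth of F on contours that stay away from the zeros. Subtracting F 0
    cancels the value of F w / cos (pi w / 2) at 0, because cos 0 = 1, so the factor 1 / w^2 leaves
    a simple pole; because the cosine has derivative 0 at 0, no correction is added to F' 0. Each
    residue is then a limit of (w - p) G w, read off from a difference quotient. The half-side 2n +
    1/2 lies between the zeros 2n - 1 and 2n + 1, at a place where cos^2 (pi x / 2) = 1/2. The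
    contour yields only the symmetric partial sums. A telescoping majorant of 1 / (2k + 1)^2 gives
    tails with an explicit rate; this rate leads from the symmetric sums to the two-ended one, and
    it also gives the uniformity on strips. The constant 4 T / pi^2 is the factor 2 / pi of the
    residues divided by the scale pi / (2 T) of the change of variable. *)

(** * Modulus and limits in the complex numbers *)

Lemma norm_normc (R : rcfType) (z : R[i]) : `|z| = (normc z)%:C.
Proof. by case: z. Qed.

Lemma normc_ge0 (R : rcfType) (z : R[i]) : 0 <= normc z.
Proof. by case: z => x y; exact: sqrtr_ge0. Qed.

Lemma normcR (R : rcfType) (x : R) : normc x%:C = `|x|.
Proof. by rewrite /= expr0n /= addr0 sqrtr_sqr. Qed.

Lemma normc_eq0 (R : rcfType) (z : R[i]) : (normc z == 0) = (z == 0).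
Proof.
apply/eqP/eqP => [/eq0_normc//|->]; exact: normc0.
Qed.

Lemma normc_gt0 (R : rcfType) (z : R[i]) : (0 < normc z) = (z != 0).
Proof. by rewrite lt_def normc_ge0 andbT normc_eq0. Qed.

Lemma normcB (R : rcfType) (z w : R[i]) : normc (z - w) = normc (w - z).
Proof. by rewrite -opprB normcN. Qed.

Lemma normc_normRe (R : rcfType) (z : R[i]) : `|Re z| <= normc z.
Proof.
case: z => x y /=; rewrite -sqrtr_sqr; apply: ler_wsqrtr.
by rewrite lerDl sqr_ge0.
Qed.

Lemma normc_normIm (R : rcfType) (z : R[i]) : `|Im z| <= normc z.
Proof.
case: z => x y /=; rewrite -sqrtr_sqr; apply: ler_wsqrtr.
by rewrite lerDr sqr_ge0.
Qed.

Lemma normc_le_ReIm (R : rcfType) (z : R[i]) : normc z <= `|Re z| + `|Im z|.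
Proof.
have -> : z = (Re z)%:C + 'i * (Im z)%:C by case: z => x y; simpc.
apply: le_trans (le_normcD _ _) _.
rewrite normcM !normcR [normc 'i]/= expr0n expr1n /= add0r sqrtr1 mul1r.
by rewrite /= !(mul0r, mul1r, mulr0, subr0, addr0, add0r).
Qed.

(** The norm of [R[i]] has its values in [R[i]], so the epsilons of its topology are complex; being
    positive they are real, and all estimates can be made with real ones. *)
Lemma cvgcP (R : realType) (T : Type) (F : set_system T) (FF : Filter F)
    (f : T -> R[i]) (l : R[i]) :
  f @ F --> l <->
  (forall e : R, 0 < e -> \forall t \near F, normc (f t - l) < e).
Proof.
split => [/cvgrPdist_lt fl e e0|fl].
  have := fl e%:C; rewrite ltcR => /(_ e0); apply: filterS => t.
  by rewrite norm_normc ltcR normcB.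
apply/cvgrPdist_lt => -[e e'] /[dup] e0; rewrite ltcE /= => /andP[/eqP e'0 e00].
have := fl _ e00; apply: filterS => t.
by rewrite norm_normc normcB e'0 complexr0 ltcR.
Qed.

Lemma cvg_Re (R : realType) (T : Type) (F : set_system T) (FF : Filter F)
    (f : T -> R[i]) (l : R[i]) :
  f @ F --> l -> (fun t => Re (f t)) @ F --> Re l.
Proof.
move=> /cvgcP fl; apply/cvgrPdist_lt => e e0; near=> t.
rewrite distrC -raddfB /=.
by apply: le_lt_trans (normc_normRe _) _; near: t; exact: fl.
Unshelve. all: by end_near. Qed.

Lemma cvg_Im (R : realType) (T : Type) (F : set_system T) (FF : Filter F)
    (f : T -> R[i]) (l : R[i]) :
  f @ F --> l -> (fun t => Im (f t)) @ F --> Im l.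
Proof.
move=> /cvgcP fl; apply/cvgrPdist_lt => e e0; near=> t.
rewrite distrC -raddfB /=.
by apply: le_lt_trans (normc_normIm _) _; near: t; exact: fl.
Unshelve. all: by end_near. Qed.

Lemma cvg_complex (R : realType) (T : Type) (F : set_system T) (FF : Filter F)
    (f g : T -> R) (a b : R) :
  f @ F --> a -> g @ F --> b -> (fun t => f t +i* g t) @ F --> a +i* b.
Proof.
move=> /cvgrPdist_lt fa /cvgrPdist_lt gb; apply/cvgcP => e e0; near=> t.
apply: le_lt_trans (normc_le_ReIm _) _; rewrite /= [ltRHS](splitr e).
rewrite distrC [in X in _ + X]distrC.
by apply: ltrD; near: t; [apply: fa|apply: gb]; rewrite divr_gt0.
Unshelve. all: by end_near. Qed.

(** * Integrals of complex functions over segments *)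

Section complex_integral.
Context {R : realType}.
Local Notation mu := (@lebesgue_measure R).
Implicit Types (a b c : R) (f g : R -> R[i]).

Lemma continuous_integrable (a b : R) (f : R -> R) :
  {in `[a, b], continuous f} -> mu.-integrable `[a, b] (EFin \o f).
Proof.
move=> cf; apply: continuous_compact_integrable; first exact: segment_compact.
by apply: continuous_in_subspaceT => x /[!inE]; exact: cf.
Qed.

(** Not an oriented integral: it is 0 when b < a, whence the order hypotheses below. *)
Definition cintegral (a b : R) (f : R -> R[i]) : R[i] :=
  (\int[mu]_(x in `[a, b]) Re (f x)) +i* (\int[mu]_(x in `[a, b]) Im (f x)).

Lemma integrable_Re a b f : {in `[a, b], continuous f} ->
  mu.-integrable `[a, b] (EFin \o (fun x => Re (f x))).
Proof. by move=> cf; apply: continuous_integrable => x xab; apply: cvg_Re; exact: cf. Qed.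

Lemma integrable_Im a b f : {in `[a, b], continuous f} ->
  mu.-integrable `[a, b] (EFin \o (fun x => Im (f x))).
Proof. by move=> cf; apply: continuous_integrable => x xab; apply: cvg_Im; exact: cf. Qed.

Lemma eq_cintegral a b f g : {in `[a, b], f =1 g} ->
  cintegral a b f = cintegral a b g.
Proof.
by move=> fg; congr (_ +i* _); apply: eq_Rintegral => x /[!inE] xab; rewrite fg.
Qed.

Lemma cintegralD a b f g :
  {in `[a, b], continuous f} -> {in `[a, b], continuous g} ->
  cintegral a b (fun x => f x + g x) = cintegral a b f + cintegral a b g.
Proof.
move=> cf cg; rewrite /cintegral.
under eq_Rintegral do rewrite raddfD.
under [X in _ +i* X]eq_Rintegral do rewrite raddfD.
rewrite /= !RintegralD //;
  [exact: integrable_Im|exact: integrable_Im|exact: integrable_Re|exact: integrable_Re].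
Qed.

Lemma cintegralZ a b f (k : R[i]) : {in `[a, b], continuous f} ->
  cintegral a b (fun x => k * f x) = k * cintegral a b f.
Proof.
move=> cf; case: k => k1 k2; rewrite /cintegral.
have reE x : Re ((k1 +i* k2) * f x) = k1 * Re (f x) - k2 * Im (f x).
  by case: (f x).
have imE x : Im ((k1 +i* k2) * f x) = k1 * Im (f x) + k2 * Re (f x).
  by case: (f x) => u v /=; rewrite mulrC.
have ire := integrable_Re cf; have iim := integrable_Im cf.
have Z k h : mu.-integrable `[a, b] (EFin \o h) ->
    mu.-integrable `[a, b] (EFin \o (fun x => k * h x)).
  by move=> ih; apply: eq_integrable (integrableZl _ k ih).
under eq_Rintegral do rewrite reE.
under [X in _ +i* X]eq_Rintegral do rewrite imE.
rewrite RintegralB ?RintegralD ?RintegralZl //; do ?exact: Z.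
Qed.

Lemma cintegral_cst a b (k : R[i]) : a <= b ->
  cintegral a b (fun=> k) = k * (b - a)%:C.
Proof.
move=> ab; rewrite /cintegral !Rintegral_cst //= lebesgue_measure_itv /=.
rewrite lte_fin; case: k => k1 k2; case: ltgtP ab => // [ab|->] _ /=.
  by simpc.
by rewrite !mulr0 subrr mulr0.
Qed.

Lemma cintegral_split m a b f : a <= m -> m <= b -> {in `[a, b], continuous f} ->
  cintegral a b f = cintegral a m f + cintegral m b f.
Proof.
move=> am mb cf.
have split h : mu.-integrable `[a, b] (EFin \o h) ->
    (\int[mu]_(x in `[a, b]) h x =
     \int[mu]_(x in `[a, m]) h x + \int[mu]_(x in `[m, b]) h x)%R.
  move=> ih; apply/eqP; rewrite addrC -subr_eq Rintegral_itvB ?bnd_simp //.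
  rewrite Rintegral_itv_obnd_cbnd //.
  by apply: integrableS ih => //; apply: subset_itvr; rewrite bnd_simp.
by rewrite /cintegral (split _ (integrable_Re cf)) (split _ (integrable_Im cf)).
Qed.

(** The factor 2 is the price of bounding the real and imaginary parts separately; it is harmless,
    since the bound is only used where the right-hand side becomes arbitrarily small. *)
Lemma le_normc_cintegral a b f (M : R) : a <= b -> {in `[a, b], continuous f} ->
  {in `[a, b], forall x, normc (f x) <= M} ->
  normc (cintegral a b f) <= 2 * M * (b - a).
Proof.
move=> ab cf fM.
have bnd h : mu.-integrable `[a, b] (EFin \o h) ->
    {in `[a, b], forall x, `|h x| <= M} ->
    `|\int[mu]_(x in `[a, b]) h x| <= M * (b - a).
  move=> ih hM; apply: le_trans (le_normr_Rintegral _ ih) _ => //.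
  apply: le_trans (@le_Rintegral _ _ _ mu _ _ (fun=> M) _ _ _ _) _ => //.
  - exact: integrable_norm ih.
  - by apply: continuous_integrable => x _; exact: cvg_cst.
  rewrite Rintegral_cst //= lebesgue_measure_itv /= lte_fin.
  by case: ltgtP ab => // -> _; rewrite subrr.
apply: le_trans (normc_le_ReIm _) _; rewrite /= -mulrA mulr_natl mulr2n.
apply: lerD; apply: bnd => [|x xab].
- exact: integrable_Re.
- exact: le_trans (normc_normRe _) (fM _ xab).
- exact: integrable_Im.
- exact: le_trans (normc_normIm _) (fM _ xab).
Qed.

End complex_integral.

(** * Goursat's theorem *)

Section rectangles.
Context {R : realType}.
Implicit Types (a b c d x y m : R) (G H : R[i] -> R[i]) (z w : R[i]).

Lemma nbhs_normcP z (P : set R[i]) :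
  (\forall w \near z, P w) <->
  (exists2 e : R, 0 < e & forall w, normc (w - z) < e -> P w).
Proof.
split=> [/nbhs_ballP[[e e'] /= /[dup] e0]|[e e0 eP]].
  rewrite ltcE /= => /andP[/eqP e'0 e00] eP; exists e => // w we.
  apply: eP; rewrite /ball /= norm_normc normcB e'0 complexr0 ltcR //.
apply/nbhs_ballP; exists e%:C; first by rewrite /= ltcR.
by move=> w; rewrite /ball /= norm_normc ltcR normcB; exact: eP.
Qed.

Lemma dnbhs_normcP z (P : set R[i]) :
  (\forall w \near z^', P w) <->
  (exists2 e : R, 0 < e & forall w, normc (w - z) < e -> w != z -> P w).
Proof. by split=> /nbhs_normcP. Qed.

Lemma hline_continuous G a b y :
  (forall x, a <= x <= b -> {for x +i* y, continuous G}) ->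
  {in `[a, b], continuous (fun x => G (x +i* y))}.
Proof.
move=> cG x xab; apply: (@cvg_comp _ _ _ (fun x => x +i* y) G).
  by apply: cvg_complex; [exact: cvg_id|exact: cvg_cst].
by apply: cG; move: xab; rewrite in_itv.
Qed.

Lemma vline_continuous G c d x :
  (forall y, c <= y <= d -> {for x +i* y, continuous G}) ->
  {in `[c, d], continuous (fun y => G (x +i* y))}.
Proof.
move=> cG y ycd; apply: (@cvg_comp _ _ _ (fun y => x +i* y) G).
  by apply: cvg_complex; [exact: cvg_cst|exact: cvg_id].
by apply: cG; move: ycd; rewrite in_itv.
Qed.

(* Counterclockwise contour integral over the boundary of [a, b] x [c, d]; the
   integrands of opposite sides are subtracted first, so that those of an affine
   [G] are constant. *)
Definition rect_integral G a b c d : R[i] :=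
  cintegral a b (fun x => G (x +i* c) - G (x +i* d))
  + 'i * cintegral c d (fun y => G (b +i* y) - G (a +i* y)).

Definition hseg_continuous G a b y :=
  forall x, a <= x <= b -> {for x +i* y, continuous G}.

Definition vseg_continuous G x c d :=
  forall y, c <= y <= d -> {for x +i* y, continuous G}.

(** Only the four sides matter, because the rectangles of the residue theorem contain poles. *)
Definition frame_continuous G a b c d :=
  [/\ hseg_continuous G a b c, hseg_continuous G a b d,
      vseg_continuous G a c d & vseg_continuous G b c d].

Lemma hdiff_continuous G a b c d :
  hseg_continuous G a b c -> hseg_continuous G a b d ->
  {in `[a, b], continuous (fun x => G (x +i* c) - G (x +i* d))}.
Proof.
move=> /hline_continuous hc /hline_continuous hd x xab.
by apply: cvgB; [exact: hc|exact: hd].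
Qed.

Lemma vdiff_continuous G a b c d :
  vseg_continuous G a c d -> vseg_continuous G b c d ->
  {in `[c, d], continuous (fun y => G (b +i* y) - G (a +i* y))}.
Proof.
move=> /vline_continuous hc /vline_continuous hd x xab.
by apply: cvgB; [exact: hd|exact: hc].
Qed.

Lemma rect_integral_splitx m G a b c d : a <= m -> m <= b ->
  frame_continuous G a b c d -> vseg_continuous G m c d ->
  rect_integral G a b c d = rect_integral G a m c d + rect_integral G m b c d.
Proof.
move=> am mb [hc hd va vb] vm; rewrite /rect_integral.
rewrite (cintegral_split am mb (hdiff_continuous hc hd)).
rewrite addrACA -mulrDr -cintegralD; [|exact: vdiff_continuous..].
by congr (_ + _ * _); apply: eq_cintegral => y _ /=; rewrite [RHS]addrC addrA subrK.
Qed.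

Lemma rect_integral_splity m G a b c d : c <= m -> m <= d ->
  frame_continuous G a b c d -> hseg_continuous G a b m ->
  rect_integral G a b c d = rect_integral G a b c m + rect_integral G a b m d.
Proof.
move=> cm md [hc hd va vb] hm; rewrite /rect_integral.
rewrite (cintegral_split cm md (vdiff_continuous va vb)).
rewrite addrACA -mulrDr -cintegralD; [|exact: hdiff_continuous..].
by congr (_ + _ * _); apply: eq_cintegral => y _ /=; rewrite addrA subrK.
Qed.

Lemma rect_integralD G H a b c d :
  frame_continuous G a b c d -> frame_continuous H a b c d ->
  rect_integral (fun w => G w + H w) a b c d =
  rect_integral G a b c d + rect_integral H a b c d.
Proof.
move=> [hc hd va vb] [hc' hd' va' vb'].
rewrite /rect_integral addrACA -mulrDr -!cintegralD;
  [|exact: vdiff_continuous|exact: vdiff_continuous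
   |exact: hdiff_continuous|exact: hdiff_continuous].
by congr (_ + _ * _); apply: eq_cintegral => x _ /=; rewrite opprD addrACA.
Qed.

Lemma rect_integralZ G (k : R[i]) a b c d : frame_continuous G a b c d ->
  rect_integral (fun w => k * G w) a b c d = k * rect_integral G a b c d.
Proof.
move=> [hc hd va vb].
rewrite /rect_integral mulrDr mulrCA -(cintegralZ k (vdiff_continuous va vb)).
rewrite -(cintegralZ k (hdiff_continuous hc hd)).
by congr (_ + _ * _); apply: eq_cintegral => x _ /=; rewrite mulrBr.
Qed.

(** The two pairs of sides have the constant integrands i D (c - d) and D (b - a), whose
    contributions cancel. This plays the role of a primitive in Goursat's argument. *)
Lemma rect_integral_affine (k D : R[i]) a b c d : a <= b -> c <= d ->
  rect_integral (fun w => k + D * w) a b c d = 0.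
Proof.
move=> ab cd; rewrite /rect_integral.
have subE (p q r s : R) : (p +i* q) - (r +i* s) = (p - r) +i* (q - s) by [].
rewrite (@eq_cintegral _ _ _ _ (fun=> D * (0 +i* (c - d)))); last first.
  move=> x _ /=; rewrite opprD addrACA subrr add0r -mulrBr.
  by rewrite subE subrr.
rewrite (@eq_cintegral _ c d _ (fun=> D * (b - a)%:C)); last first.
  move=> x _ /=; rewrite opprD addrACA subrr add0r -mulrBr.
  by rewrite subE subrr.
rewrite (cintegral_cst _ ab) (cintegral_cst _ cd).
have -> : D * (0 +i* (c - d)) * (b - a)%:C + 'i * (D * (b - a)%:C * (d - c)%:C)
    = D * ((0 +i* (c - d)) * (b - a)%:C + 'i * ((b - a)%:C * (d - c)%:C)).
  by ring.
suff -> : (0 +i* (c - d)) * (b - a)%:C + 'i * ((b - a)%:C * (d - c)%:C) = 0.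
  by rewrite mulr0.
by simpc; congr (_ +i* _); ring.
Qed.

Lemma le_normc_rect_integral G (M : R) a b c d : a <= b -> c <= d ->
  frame_continuous G a b c d ->
  (forall x, a <= x <= b -> normc (G (x +i* c)) <= M) ->
  (forall x, a <= x <= b -> normc (G (x +i* d)) <= M) ->
  (forall y, c <= y <= d -> normc (G (a +i* y)) <= M) ->
  (forall y, c <= y <= d -> normc (G (b +i* y)) <= M) ->
  normc (rect_integral G a b c d) <= 4 * M * ((b - a) + (d - c)).
Proof.
move=> ab cd [hc hd va vb] Mc Md Ma Mb.
apply: le_trans (le_normcD _ _) _; rewrite normcM.
have -> : normc ('i : R[i]) = 1.
  by rewrite /= expr0n expr1n /= add0r sqrtr1.
rewrite mul1r [leRHS]mulrDr.
have -> : 4 * M = 2 * (M + M) by ring.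
apply: lerD.
  apply: le_normc_cintegral ab (hdiff_continuous hc hd) _ => x.
  rewrite in_itv /= => xab; apply: le_trans (le_normcD _ _) _; rewrite normcN.
  by apply: lerD; [exact: Mc|exact: Md].
apply: le_normc_cintegral cd (vdiff_continuous va vb) _ => x.
rewrite in_itv /= => xab; apply: le_trans (le_normcD _ _) _; rewrite normcN.
by apply: lerD; [exact: Mb|exact: Ma].
Qed.

Lemma nested_intervals (u v : nat -> R) :
  (forall n, u n <= u n.+1) -> (forall n, v n.+1 <= v n) ->
  (forall n, u n <= v n) -> exists x, forall n, u n <= x <= v n.
Proof.
move=> uS vS uv.
have u_le i j : (i <= j)%N -> u i <= u j by apply: (@homo_leq _ u <=%R) => // ? ? ?; exact: le_trans.
have v_le i j : (i <= j)%N -> v j <= v i by apply: (@homo_leq _ v (fun x y => y <= x)) => // ? ? ? h1 h2; exact: le_trans h2 h1.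
have uv' i j : u i <= v j.
  apply: le_trans (u_le _ _ (leq_maxl i j)) _.
  exact: le_trans (uv _) (v_le _ _ (leq_maxr i j)).
exists (sup (range u)) => n; apply/andP; split.
  by apply: ub_le_sup; [exists (v 0) => _ [m _ <-]; exact: uv'|exists n].
by apply: ge_sup; [exists (u 0), 0|move=> _ [m _ <-]; exact: uv'].
Qed.

(** If [P] failed, it would fail on some quarter, and the nested failing rectangles would shrink to
    a point near which [P] holds. In the local hypothesis the small rectangles may stick out of the
    given one. *)
Lemma rect_bisection (P : R -> R -> R -> R -> Prop) a b c d :
  a <= b -> c <= d ->
  (forall a b c d, a <= b -> c <= d ->
     let m := (a + b) / 2 in let n := (c + d) / 2 in
     P a m c n -> P m b c n -> P a m n d -> P m b n d -> P a b c d) ->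
  (forall x y, a <= x <= b -> c <= y <= d ->
     exists2 e : R, 0 < e &
       forall a' b' c' d', a' <= x <= b' -> c' <= y <= d' ->
         b' - a' < e -> d' - c' < e -> P a' b' c' d') ->
  P a b c d.
Proof.
move=> ab cd Psplit Ploc; apply: contrapT => nP.
pose good (q : R * R * R * R) :=
  [/\ q.1.1.1 <= q.1.1.2, q.1.2 <= q.2 & ~ P q.1.1.1 q.1.1.2 q.1.2 q.2].
(* [good q] is assumed inside the existential, so that choice gives a total map that can be
   iterated. *)
have step (q : R * R * R * R) : exists q' : R * R * R * R, good q ->
    [/\ good q', q.1.1.1 <= q'.1.1.1 /\ q'.1.1.2 <= q.1.1.2,
        q.1.2 <= q'.1.2 /\ q'.2 <= q.2,
        q'.1.1.2 - q'.1.1.1 = (q.1.1.2 - q.1.1.1) / 2 &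
        q'.2 - q'.1.2 = (q.2 - q.1.2) / 2].
  case: q => [[[a1 b1] c1] d1]; rewrite /good /=.
  case: (pselect (a1 <= b1 /\ c1 <= d1)) => [[ab1 cd1]|h]; last first.
    by exists (a1, b1, c1, d1) => -[? ?]; case: h.
  pose m := (a1 + b1) / 2; pose n := (c1 + d1) / 2.
  have am : a1 <= m by rewrite /m; lra.
  have mb : m <= b1 by rewrite /m; lra.
  have cn : c1 <= n by rewrite /n; lra.
  have nd : n <= d1 by rewrite /n; lra.
  have [P1|P1] := pselect (P a1 m c1 n); last first.
    by exists (a1, m, c1, n) => _ /=; split=> //; rewrite /m /n; lra.
  have [P2|P2] := pselect (P m b1 c1 n); last first.
    by exists (m, b1, c1, n) => _ /=; split=> //; rewrite /m /n; lra.
  have [P3|P3] := pselect (P a1 m n d1); last first.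
    by exists (a1, m, n, d1) => _ /=; split=> //; rewrite /m /n; lra.
  have [P4|P4] := pselect (P m b1 n d1); last first.
    by exists (m, b1, n, d1) => _ /=; split=> //; rewrite /m /n; lra.
  by exists (a1, b1, c1, d1) => -[_ _]; case; exact: Psplit.
have {step}[next nextP] := choice step.
pose q n := iter n next (a, b, c, d).
have qgood n : good (q n).
  by elim: n => [|n IH]; [split|case: (nextP _ IH)].
have qP n := nextP _ (qgood n).
have [x xq] : exists x, forall n, (q n).1.1.1 <= x <= (q n).1.1.2.
  apply: nested_intervals => n; rewrite -?[q n.+1]/(next (q n)).
  - by case: (qP n) => _ [].
  - by case: (qP n) => _ [].
  - by case: (qgood n).
have [y yq] : exists y, forall n, (q n).1.2 <= y <= (q n).2.
  apply: nested_intervals => n; rewrite -?[q n.+1]/(next (q n)).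
  - by case: (qP n) => _ _ [].
  - by case: (qP n) => _ _ [].
  - by case: (qgood n).
have wx n : (q n).1.1.2 - (q n).1.1.1 = (b - a) / 2 ^+ n.
  elim: n => [|n IH]; first by rewrite expr0 divr1.
  by case: (qP n) => _ _ _ -> _; rewrite IH exprSr invfM mulrA.
have wy n : (q n).2 - (q n).1.2 = (d - c) / 2 ^+ n.
  elim: n => [|n IH]; first by rewrite expr0 divr1.
  by case: (qP n) => _ _ _ _ ->; rewrite IH exprSr invfM mulrA.
have [e e0 eP] := Ploc x y (xq 0%N) (yq 0%N).
(* After k + 1 halvings the sides are shorter than e, because 2^(k+1) > k + 1 > ((b - a) + (d - c))
   / e. *)
pose k := Num.truncn (((b - a) + (d - c)) / e).
have small t : t <= (b - a) + (d - c) -> t / 2 ^+ k.+1 < e.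
  move=> ts; rewrite ltr_pdivrMr ?exprn_gt0 //.
  apply: le_lt_trans ts _; rewrite mulrC -ltr_pdivrMr //.
  apply: lt_trans (truncnS_gt _) _.
  by rewrite -natrX ltr_nat ltn_expl.
case: (qgood k.+1) => _ _; apply; apply: eP => //.
- by rewrite wx; apply: small; lra.
- by rewrite wy; apply: small; lra.
Qed.

(** The estimate is free of division, so it also covers w = z, as needed on frames that pass through
    z. *)
Lemma derivable_estimate G z : derivable G z 1 ->
  exists D, forall e : R, 0 < e -> exists2 r : R, 0 < r &
    forall w, normc (w - z) < r ->
      normc (G w - G z - D * (w - z)) <= e * normc (w - z).
Proof.
move=> /cvg_ex[D /cvgcP dG]; exists D => e /dG /dnbhs_normcP[r r0 rP].
exists r => // w wr; have [->|wz] := eqVneq w z.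
  by rewrite !subrr mulr0 subrr normc0 mulr0.
have wz0 : w - z != 0 by rewrite subr_eq0.
have := rP (w - z); rewrite subr0 => /(_ wr wz0) /ltW.
rewrite /GRing.scale /= mulr1 subrK => h.
have -> : G w - G z - D * (w - z) = ((w - z)^-1 * (G w - G z) - D) * (w - z).
  by rewrite mulrBl mulrAC mulVf // mul1r.
by rewrite normcM ler_wpM2r // normc_ge0.
Qed.

Lemma derivable_continuous G z : derivable G z 1 -> {for z, continuous G}.
Proof. by move=> /derivable1_diffP /differentiable_continuous. Qed.

Lemma affine_derivable (k D z : R[i]) : derivable (fun w => k + D * w) z 1.
Proof.
apply: derivableD; first exact: derivable_cst.
by apply: derivableM; [exact: derivable_cst|exact: derivable_id].
Qed.

Lemma continuous_frame G a b c d : a <= b -> c <= d ->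
  (forall x y, a <= x <= b -> c <= y <= d -> {for x +i* y, continuous G}) ->
  frame_continuous G a b c d.
Proof. by move=> ab cd cG; split=> u uP; apply: cG; rewrite ?lexx ?ab ?cd. Qed.

(** The bound is quadratic in the half-perimeter s, which makes it stable under bisection: the four
    quarters add up to 4 e (s / 2)^2 = e s^2. Near a point it holds because G is, up to an affine
    function of zero integral, o(s) on a frame of length 2 s. *)
Theorem goursat G a b c d : a <= b -> c <= d ->
  (forall x y, a <= x <= b -> c <= y <= d -> derivable G (x +i* y) 1) ->
  rect_integral G a b c d = 0.
Proof.
move=> ab cd dG.
have cG x y : a <= x <= b -> c <= y <= d -> {for x +i* y, continuous G}.
  by move=> xab ycd; apply: derivable_continuous; exact: dG.
suff bound (e : R) : 0 < e ->
    normc (rect_integral G a b c d) <= e * ((b - a) + (d - c)) ^+ 2.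
  apply/eqP; rewrite -normc_eq0 eq_le normc_ge0 andbT.
  apply/ler_addgt0Pr => e e0; rewrite add0r.
  set s := (b - a) + (d - c) in bound.
  have s1 : 0 < s ^+ 2 + 1 by rewrite ltr_wpDl // sqr_ge0.
  apply: le_trans (bound (e / (s ^+ 2 + 1)) _) _; first by rewrite divr_gt0.
  by rewrite mulrAC ler_pdivrMr // ler_pM2l // lerDl.
move=> e0.
(* [P] includes the condition that the rectangle lies in the given one, where [G] is
   differentiable. *)
pose P a' b' c' d' := a <= a' -> b' <= b -> c <= c' -> d' <= d ->
  a' <= b' -> c' <= d' ->
  normc (rect_integral G a' b' c' d') <= e * ((b' - a') + (d' - c')) ^+ 2.
suff : P a b c d by apply.
apply: (@rect_bisection P) => // [a' b' c' d' ab' cd' m n P1 P2 P3 P4|x y xab ycd].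
  move=> aa bb cc dd _ _.
  have am : a' <= m by rewrite /m; lra.
  have mb : m <= b' by rewrite /m; lra.
  have cn : c' <= n by rewrite /n; lra.
  have nd : n <= d' by rewrite /n; lra.
  have cG' x y : a' <= x <= b' -> c' <= y <= d' -> {for x +i* y, continuous G}.
    by move=> /andP[? ?] /andP[? ?]; apply: cG; apply/andP; split; lra.
  have fr a1 b1 c1 d1 : a' <= a1 -> a1 <= b1 -> b1 <= b' -> c' <= c1 ->
      c1 <= d1 -> d1 <= d' -> frame_continuous G a1 b1 c1 d1.
    move=> *; apply: continuous_frame => // x y /andP[? ?] /andP[? ?].
    by apply: cG'; apply/andP; split; lra.
  rewrite (@rect_integral_splitx m) //; [|exact: fr|]; last first.
    by move=> y yc; apply: cG' => //; rewrite am mb.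
  rewrite (@rect_integral_splity n _ a' m) //; [|by apply: fr|]; last first.
    move=> x /andP[x1 x2]; apply: cG' => //; last by rewrite cn nd.
    by rewrite x1 (le_trans x2 mb).
  rewrite (@rect_integral_splity n _ m b') //; [|by apply: fr|]; last first.
    move=> x /andP[x1 x2]; apply: cG' => //; last by rewrite cn nd.
    by rewrite x2 (le_trans am x1).
  have := P1 aa (le_trans mb bb) cc (le_trans nd dd) am cn.
  have := P2 (le_trans aa am) bb cc (le_trans nd dd) mb cn.
  have := P3 aa (le_trans mb bb) (le_trans cc cn) dd am nd.
  have := P4 (le_trans aa am) bb (le_trans cc cn) dd mb nd.
  move=> h4 h3 h2 h1.
  apply: le_trans (le_normcD _ _) _.
  apply: le_trans (lerD (le_normcD _ _) (le_normcD _ _)) _.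
  apply: le_trans (lerD (lerD h1 h3) (lerD h2 h4)) _.
  by rewrite le_eqVlt; apply/orP; left; apply/eqP; rewrite /m /n; field.
have [D dP] := derivable_estimate (dG x y xab ycd).
(* The 4 undoes the factor of [le_normc_rect_integral]. *)
have e40 : 0 < e / 4 by rewrite divr_gt0.
have [r r0 rP] := dP _ e40.
(* Half of r, because the distance to z is bounded by the sum of the two sides. *)
exists (r / 2); first by rewrite divr_gt0.
move=> a' b' c' d' /andP[ax xb] /andP[cy yd] wx wy aa bb cc dd ab' cd'.
set s := (b' - a') + (d' - c').
set z := x +i* y in dP rP *.
pose k := G z - D * z; pose E w := G w - (k + D * w).
have -> : rect_integral G a' b' c' d' = rect_integral E a' b' c' d'.
  have -> : G = (fun w => (k + D * w) + E w).
    by apply/funext => w; rewrite addrC subrK.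
  rewrite rect_integralD ?rect_integral_affine ?add0r //.
    apply: continuous_frame => // u v _ _.
    by apply: derivable_continuous; exact: affine_derivable.
  apply: continuous_frame => // u v /andP[? ?] /andP[? ?].
  apply: derivable_continuous; apply: derivableB.
    by apply: dG; apply/andP; split; lra.
  exact: affine_derivable.
have Ebound u v : a' <= u <= b' -> c' <= v <= d' ->
    normc (E (u +i* v)) <= e / 4 * s.
  move=> /andP[? ?] /andP[? ?].
  have us : normc ((u +i* v) - z) <= s.
    apply: le_trans (normc_le_ReIm _) _; rewrite /= /s.
    by apply: lerD; rewrite ler_norml; apply/andP; split; lra.
  have -> : E (u +i* v) = G (u +i* v) - G z - D * ((u +i* v) - z).
    by rewrite /E /k; ring.
  apply: le_trans (rP _ _) _; first by apply: le_lt_trans us _; rewrite /s; lra.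
  by rewrite ler_wpM2l // ltW.
have -> : e * s ^+ 2 = 4 * (e / 4 * s) * s by field.
apply: le_normc_rect_integral => //; last 4 first.
- by move=> u up; apply: Ebound => //; rewrite lexx.
- by move=> u up; apply: Ebound => //; rewrite lexx cd'.
- by move=> u up; apply: Ebound => //; rewrite lexx ab'.
- by move=> u up; apply: Ebound => //; rewrite lexx ab'.
apply: continuous_frame => // u v /andP[? ?] /andP[? ?].
apply: derivable_continuous; apply: derivableB.
  by apply: dG; apply/andP; split; lra.
exact: affine_derivable.
Qed.

End rectangles.

(** * Residues at simple poles *)

Section residues.
Context {R : realType}.
Implicit Types (a b c d x y m : R) (G H : R[i] -> R[i]) (z w p : R[i]).

(** The part outside the smaller rectangle is cut into four bands (left, right, bottom, top); none
    contains p, so Goursat's theorem removes each. *)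
Lemma rect_integral_shrink G p a b c d a' b' c' d' :
  a <= a' -> b' <= b -> c <= c' -> d' <= d ->
  a' < Re p -> Re p < b' -> c' < Im p -> Im p < d' ->
  (forall x y, a <= x <= b -> c <= y <= d -> x +i* y != p ->
     derivable G (x +i* y) 1) ->
  rect_integral G a b c d = rect_integral G a' b' c' d'.
Proof.
case: p => u v /= aa bb cc dd au ub cv vd dG.
have neqx x y : x != u -> x +i* y != u +i* v.
  by move=> xu; rewrite eq_complex /= (negbTE xu).
have neqy x y : y != v -> x +i* y != u +i* v.
  by move=> yv; rewrite eq_complex /= (negbTE yv) andbF.
have ltx x : x < u -> x != u by move=> h; rewrite lt_eqF.
have gtx x : u < x -> x != u by move=> h; rewrite gt_eqF.
have lty x : x < v -> x != v by move=> h; rewrite lt_eqF.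
have gty x : v < x -> x != v by move=> h; rewrite gt_eqF.
have hs a1 b1 y : a <= a1 -> b1 <= b -> c <= y <= d -> y != v ->
    hseg_continuous G a1 b1 y.
  move=> ? ? ? yv x /andP[? ?]; apply: derivable_continuous.
  by apply: dG => //; [apply/andP; split; lra|exact: neqy].
have vs x c1 d1 : c <= c1 -> d1 <= d -> a <= x <= b -> x != u ->
    vseg_continuous G x c1 d1.
  move=> ? ? ? xu y /andP[? ?]; apply: derivable_continuous.
  by apply: dG => //; [apply/andP; split; lra|exact: neqx].
have cin : c <= c <= d by apply/andP; split; lra.
have din : c <= d <= d by apply/andP; split; lra.
have c'in : c <= c' <= d by apply/andP; split; lra.
have d'in : c <= d' <= d by apply/andP; split; lra.
have ain : a <= a <= b by apply/andP; split; lra.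
have bin : a <= b <= b by apply/andP; split; lra.
have a'in : a <= a' <= b by apply/andP; split; lra.
have b'in : a <= b' <= b by apply/andP; split; lra.
have cn : c != v by apply: lty; lra.
have dn : d != v by apply: gty; lra.
have an : a != u by apply: ltx; lra.
have bn : b != u by apply: gtx; lra.
have c'n : c' != v by apply: lty; lra.
have d'n : d' != v by apply: gty; lra.
have a'n : a' != u by apply: ltx; lra.
have b'n : b' != u by apply: gtx; lra.
have fr a1 b1 c1 d1 : a <= a1 <= b -> a <= b1 <= b -> c <= c1 <= d ->
    c <= d1 <= d -> a1 != u -> b1 != u -> c1 != v -> d1 != v ->
    frame_continuous G a1 b1 c1 d1.
  move=> /andP[? ?] /andP[? ?] /andP[? ?] /andP[? ?] ? ? ? ?.
  by split; [apply: hs|apply: hs|apply: vs|apply: vs] => //; apply/andP; split.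
rewrite (@rect_integral_splitx _ a') //; [|lra|exact: fr|exact: vs].
rewrite (@goursat _ _ a a') ?add0r //; [|lra|]; last first.
  move=> x y /andP[? ?] ycd; apply: dG => //; first by apply/andP; split; lra.
  by apply: neqx; apply: ltx; lra.
rewrite (@rect_integral_splitx _ b') //; [|lra|exact: fr|exact: vs].
rewrite (@goursat _ _ b' b) ?addr0 //; [|lra|]; last first.
  move=> x y /andP[? ?] ycd; apply: dG => //; first by apply/andP; split; lra.
  by apply: neqx; apply: gtx; lra.
rewrite (@rect_integral_splity _ c') //; [|lra|exact: fr|apply: hs => //; lra].
rewrite (@goursat _ _ _ _ c c') ?add0r //; [|lra|]; last first.
  move=> x y /andP[? ?] /andP[? ?].
  apply: dG; [by apply/andP; split; lra|by apply/andP; split; lra|].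
  by apply: neqy; apply: lty; lra.
rewrite (@rect_integral_splity _ d') //; [|lra|exact: fr|apply: hs => //; lra].
rewrite (@goursat _ _ _ _ d' d) ?addr0 //; [lra|].
move=> x y /andP[? ?] /andP[? ?].
apply: dG; [by apply/andP; split; lra|by apply/andP; split; lra|].
by apply: neqy; apply: gty; lra.
Qed.

(** The primitive 2 atan ((x - a) / s) increases from - pi / 2 to pi / 2. *)
Lemma Rintegral_poisson (a s : R) : 0 < s ->
  (\int[lebesgue_measure]_(x in `[(a - s)%R, (a + s)%R])
     (2 * s / ((x - a) ^+ 2 + s ^+ 2)))%R = pi.
Proof.
move=> s0.
have s_neq0 : s != 0 by rewrite gt_eqF.
pose F x : R := 2 * atan ((x - a) * s^-1).
have den x : 0 < (x - a) ^+ 2 + s ^+ 2.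
  by rewrite ltr_wpDl ?sqr_ge0 // exprn_gt0.
have dF x : is_derive x 1 F (2 * s / ((x - a) ^+ 2 + s ^+ 2)).
  apply: is_derive_eq.
  rewrite /GRing.scale /=; field.
  by rewrite !gt_eqF //= addrC.
have cF x : {for x, continuous F}.
  by apply: differentiable_continuous; apply/derivable1_diffP; case: (dF x).
have ch x : {for x, continuous (fun x : R => 2 * s / ((x - a) ^+ 2 + s ^+ 2))}.
  apply: differentiable_continuous; apply/derivable1_diffP.
  apply: derivableM; first exact: derivable_cst.
  apply: derivableV; first by rewrite gt_eqF.
  by [].
rewrite /Rintegral (@continuous_FTC2 _ _ F).
- rewrite /= /F.
  have -> : a + s - a = s by ring.
  have -> : a - s - a = - s by ring.
  by rewrite mulNr divff // atanN atan1; field.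
- by lra.
- by apply: continuous_subspaceT => x; exact: ch.
- split.
  + by move=> x _; case: (dF x).
  + by apply: cvg_at_right_filter; exact: cF.
  + by apply: cvg_at_left_filter; exact: cF.
- by move=> x _; rewrite derive1E; case: (dF x).
Qed.

(** On a square centred at p, opposite sides combine to Poisson kernels: 1 / (t - i s) - 1 / (t + i
    s) = 2 i s / (t^2 + s^2) for the horizontal ones and 1 / (s + i t) - 1 / (- s + i t) = 2 s /
    (t^2 + s^2) for the vertical ones. Each pair contributes i pi. *)
Lemma rect_integral_inv p s : 0 < s ->
  rect_integral (fun w => (w - p)^-1) (Re p - s) (Re p + s) (Im p - s) (Im p + s)
  = (2 * pi)%:C * 'i.
Proof.
case: p => u v /= s0.
have den x : 0 < x ^+ 2 + s ^+ 2 by rewrite ltr_wpDl ?sqr_ge0 // exprn_gt0.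
have subE (x y x' y' : R) : (x +i* y) - (x' +i* y') = (x - x') +i* (y - y').
  by [].
have invE (x y : R) : (x +i* y)^-1 =
    (x / (x ^+ 2 + y ^+ 2)) +i* (- (y / (x ^+ 2 + y ^+ 2))) by [].
rewrite /rect_integral.
rewrite (@eq_cintegral _ _ _ _
  (fun x => 0 +i* (2 * s / ((x - u) ^+ 2 + s ^+ 2)))); last first.
  move=> x _; rewrite (subE x (v - s)) (subE x (v + s)) !invE subE.
  have := den (x - u).
  set t := x - u => h.
  have -> : v - s - v = - s by ring.
  have -> : v + s - v = s by ring.
  rewrite sqrrN; congr (_ +i* _); field; by rewrite gt_eqF.
rewrite (@eq_cintegral _ (v - s) _ _
  (fun x => (2 * s / ((x - v) ^+ 2 + s ^+ 2)) +i* 0)); last first.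
  move=> x _; rewrite (subE (u + s)) (subE (u - s)) !invE subE.
  have := den (x - v).
  set t := x - v => h.
  have -> : u - s - u = - s by ring.
  have -> : u + s - u = s by ring.
  rewrite sqrrN [s ^+ 2 + _]addrC; congr (_ +i* _); field; by rewrite gt_eqF.
rewrite /cintegral /= !Rintegral_poisson // !Rintegral_cst //= !mul0r.
by simpc; congr (_ +i* _); ring.
Qed.

(** On a small square of half-side s around p, G differs from rho / (w - p) by ((w - p) G w - rho) /
    (w - p). This is o(1 / s) on the frame, whose length is proportional to s, so its integral can
    be made arbitrarily small. *)
Theorem residue_simple_pole G p (rho : R[i]) a b c d :
  a < Re p -> Re p < b -> c < Im p -> Im p < d ->
  (forall x y, a <= x <= b -> c <= y <= d -> x +i* y != p ->
     derivable G (x +i* y) 1) ->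
  (w - p) * G w @[w --> p^'] --> rho ->
  rect_integral G a b c d = (2 * pi)%:C * 'i * rho.
Proof.
move=> ap pb cp pd dG /cvgcP lim.
apply/eqP; rewrite -subr_eq0 -normc_eq0 eq_le normc_ge0 andbT.
apply/ler_addgt0Pr => e e0; rewrite add0r.
(* 16 is the factor 4 of [le_normc_rect_integral] times the half-perimeter 4 s divided by s. *)
have e16 : 0 < e / 16 by rewrite divr_gt0.
have [r r0 rP] := (dnbhs_normcP _ _).1 (lim _ e16).
(* The bound r / 4 puts the frame within distance 2 s < r of p; the others keep the square inside
   the rectangle. *)
pose s := Num.min (r / 4) (Num.min (Num.min (Re p - a) (b - Re p))
  (Num.min (Im p - c) (d - Im p))).
have s0 : 0 < s by rewrite !lt_min !subr_gt0 ap pb cp pd divr_gt0.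
have : s <= s by [].
rewrite {2}/s !le_min => /and3P[sr /andP[sa sb] /andP[sc sd]].
rewrite (@rect_integral_shrink G p _ _ _ _ (Re p - s) (Re p + s) (Im p - s)
  (Im p + s)) //; [|lra..].
pose psi w := G w + (- rho) * (w - p)^-1.
have onframe w : `|Re w - Re p| <= s -> `|Im w - Im p| <= s ->
    `|Re w - Re p| = s \/ `|Im w - Im p| = s ->
    [/\ w != p, derivable G w 1 & normc (psi w) <= e / 16 / s].
  move=> rw iw bw.
  have sw : s <= normc (w - p).
    case: bw => <-; rewrite -raddfB /=.
      exact: normc_normRe.
    exact: normc_normIm.
  have wp : w != p.
    by rewrite -subr_eq0 -normc_gt0; apply: lt_le_trans sw.
  split => //.
    case: w wp rw iw {bw sw} => x y /= wp.
    rewrite !ler_norml => /andP[? ?] /andP[? ?].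
    by apply: dG => //; apply/andP; split; lra.
  have ws : normc (w - p) < r.
    apply: le_lt_trans (normc_le_ReIm _) _; rewrite !raddfB /=; lra.
  have -> : psi w = ((w - p) * G w - rho) * (w - p)^-1.
    by rewrite /psi mulrBl mulNr mulrAC divff ?subr_eq0 // mul1r.
  rewrite normcM normcV.
  apply: ler_pM; rewrite ?normc_ge0 ?invr_ge0 ?normc_ge0 //.
    exact/ltW/rP.
  by rewrite lef_pV2 // posrE; apply: lt_le_trans sw.
pose u := Re p; pose v := Im p.
have hl t : `|t - u| <= s -> [/\ `|Re (t +i* (v - s)) - u| <= s,
    `|Im (t +i* (v - s)) - v| <= s & `|Im (t +i* (v - s)) - v| = s].
  move=> tu; split=> //=; have -> : v - s - v = - s by ring.
    by rewrite normrN gtr0_norm.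
  by rewrite normrN gtr0_norm.
have hh t : `|t - u| <= s -> [/\ `|Re (t +i* (v + s)) - u| <= s,
    `|Im (t +i* (v + s)) - v| <= s & `|Im (t +i* (v + s)) - v| = s].
  move=> tu; split=> //=; have -> : v + s - v = s by ring.
    by rewrite gtr0_norm.
  by rewrite gtr0_norm.
have vl t : `|t - v| <= s -> [/\ `|Re ((u - s) +i* t) - u| <= s,
    `|Im ((u - s) +i* t) - v| <= s & `|Re ((u - s) +i* t) - u| = s].
  move=> tu; split=> //=; have -> : u - s - u = - s by ring.
    by rewrite normrN gtr0_norm.
  by rewrite normrN gtr0_norm.
have vh t : `|t - v| <= s -> [/\ `|Re ((u + s) +i* t) - u| <= s,
    `|Im ((u + s) +i* t) - v| <= s & `|Re ((u + s) +i* t) - u| = s].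
  move=> tu; split=> //=; have -> : u + s - u = s by ring.
    by rewrite gtr0_norm.
  by rewrite gtr0_norm.
have cen t k : k - s <= t <= k + s -> `|t - k| <= s.
  by move=> /andP[? ?]; rewrite ler_norml; apply/andP; split; lra.
have ok_hl t : u - s <= t <= u + s -> [/\ t +i* (v - s) != p,
    derivable G (t +i* (v - s)) 1 & normc (psi (t +i* (v - s))) <= e / 16 / s].
  by move=> /cen /hl[? ? ?]; apply: onframe => //; right.
have ok_hh t : u - s <= t <= u + s -> [/\ t +i* (v + s) != p,
    derivable G (t +i* (v + s)) 1 & normc (psi (t +i* (v + s))) <= e / 16 / s].
  by move=> /cen /hh[? ? ?]; apply: onframe => //; right.
have ok_vl t : v - s <= t <= v + s -> [/\ (u - s) +i* t != p,
    derivable G ((u - s) +i* t) 1 & normc (psi ((u - s) +i* t)) <= e / 16 / s].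
  by move=> /cen /vl[? ? ?]; apply: onframe => //; left.
have ok_vh t : v - s <= t <= v + s -> [/\ (u + s) +i* t != p,
    derivable G ((u + s) +i* t) 1 & normc (psi ((u + s) +i* t)) <= e / 16 / s].
  by move=> /cen /vh[? ? ?]; apply: onframe => //; left.
have dinv w : w != p -> derivable (fun w => (w - p)^-1) w 1.
  move=> wp; apply: derivableV; first by rewrite subr_eq0.
  by apply: derivableB; [exact: derivable_id|exact: derivable_cst].
have dpsi w : w != p -> derivable G w 1 -> derivable psi w 1.
  move=> wp dGw; apply: derivableD; first exact: dGw.
  by apply: derivableM; [exact: derivable_cst|exact: dinv].
have fr H : (forall w, w != p -> derivable G w 1 -> derivable H w 1) ->
    frame_continuous H (u - s) (u + s) (v - s) (v + s).
  move=> dH; split => t tin; apply: derivable_continuous; apply: dH.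
  - by case: (ok_hl _ tin).
  - by case: (ok_hl _ tin).
  - by case: (ok_hh _ tin).
  - by case: (ok_hh _ tin).
  - by case: (ok_vl _ tin).
  - by case: (ok_vl _ tin).
  - by case: (ok_vh _ tin).
  - by case: (ok_vh _ tin).
have -> : G = (fun w => psi w + rho * (w - p)^-1).
  by apply/funext => w; rewrite /psi -addrA mulNr addNr addr0.
rewrite rect_integralD; [|exact: fr|]; last first.
  apply: fr => w wp _.
  by apply: derivableM; [exact: derivable_cst|exact: dinv].
rewrite rect_integralZ; last by apply: fr => w wp _; exact: dinv.
rewrite rect_integral_inv // [rho * _]mulrC addrK.
have -> : e = 4 * (e / 16 / s) * ((u + s - (u - s)) + (v + s - (v - s))).
  by field; rewrite gt_eqF.
apply: le_normc_rect_integral; [lra|lra|exact: fr|..] => t tin.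
- by case: (ok_hl _ tin).
- by case: (ok_hh _ tin).
- by case: (ok_vl _ tin).
- by case: (ok_vh _ tin).
Qed.

End residues.

(** * Complex derivatives as limits of difference quotients *)

Section complex_derivative.
Context {R : realType}.
Implicit Types (G : R[i] -> R[i]) (z w : R[i]).

(** The quotient in w, rather than in the increment, is the form that occurs in residues and in
    polar derivatives. *)
Lemma is_derive_cvg G z (D : R[i]) : is_derive z 1 G D <->
  ((w - z)^-1 * (G w - G z) @[w --> z^'] --> D).
Proof.
split=> [dG|/cvgcP dG].
  have /cvgcP lim : h^-1 *: (G (h *: 1 + z) - G z) @[h --> 0^'] --> D.
    by case: dG => dG <-; exact: dG.
  apply/cvgcP => e /lim /dnbhs_normcP[r r0 rP].
  apply/dnbhs_normcP; exists r => // w wr wz.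
  have := rP (w - z); rewrite subr0 subr_eq0 => /(_ wr wz).
  by rewrite /GRing.scale /= mulr1 subrK.
have lim : h^-1 *: (G (h *: 1 + z) - G z) @[h --> 0^'] --> D.
  apply/cvgcP => e /dG /dnbhs_normcP[r r0 rP].
  apply/dnbhs_normcP; exists r => // h; rewrite subr0 => hr h0.
  have := rP (h + z); rewrite addrK => /(_ hr).
  have hz : h + z != z by rewrite -subr_eq0 addrK.
  by move=> /(_ hz); rewrite /GRing.scale /= mulr1.
split; first by apply/cvg_ex; exists D.
rewrite /derive; apply: cvg_lim lim; exact: norm_hausdorff.
Qed.

Lemma is_derive_estimate G z (D : R[i]) :
  (forall e : R, 0 < e -> exists2 r : R, 0 < r &
    forall h, normc h < r ->
      normc (G (z + h) - G z - D * h) <= e * normc h) ->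
  is_derive z 1 G D.
Proof.
move=> dG; apply/is_derive_cvg/cvgcP => e e0.
have e20 : 0 < e / 2 by rewrite divr_gt0.
have [r r0 rP] := dG _ e20; apply/dnbhs_normcP; exists r => // w wr wz.
have wz0 : w - z != 0 by rewrite subr_eq0.
have -> : (w - z)^-1 * (G w - G z) - D = (G w - G z - D * (w - z)) / (w - z).
  by rewrite mulrBl mulfK // mulrC.
rewrite normcM normcV ltr_pdivrMr ?normc_gt0 //.
have := rP _ wr; rewrite [z + _]addrC subrK => /le_lt_trans; apply.
by rewrite ltr_pM2r ?normc_gt0 // ltr_pdivrMr // ltr_pMr // ltr1n.
Qed.

Lemma cvg_id_dnbhs (p : R[i]) : w @[w --> p^'] --> p.
Proof.
apply/cvgcP => e e0; apply/dnbhs_normcP; by exists e.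
Qed.

Lemma cvg_dnbhs_continuous (g : R[i] -> R[i]) (p : R[i]) : derivable g p 1 ->
  g w @[w --> p^'] --> g p.
Proof.
move=> /derivable_continuous /cvgcP gc; apply/cvgcP => e.
move=> /gc /nbhs_normcP[r r0 rP]; apply/dnbhs_normcP; exists r => // w wr _.
exact: rP.
Qed.

Lemma is_derive_affine (G : R[i] -> R[i]) z (k D : R[i]) w : k != 0 ->
  is_derive (z + k * w) 1 G D ->
  is_derive w 1 (fun w => G (z + k * w)) (k * D).
Proof.
move=> k0 /is_derive_cvg /cvgcP lim; apply/is_derive_cvg/cvgcP => e e0.
have nk : 0 < normc k by rewrite normc_gt0.
have [r r0 rP] := (dnbhs_normcP _ _).1 (lim _ (divr_gt0 e0 nk)).
apply/dnbhs_normcP; exists (r / normc k); first by rewrite divr_gt0.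
move=> w' wr ww.
have wE : z + k * w' - (z + k * w) = k * (w' - w) by ring.
have ww0 : w' - w != 0 by rewrite subr_eq0.
have := rP (z + k * w'); rewrite wE normcM mulrC -ltr_pdivlMr // => /(_ wr).
rewrite -subr_eq0 wE mulf_neq0 // => /(_ isT).
rewrite ltr_pdivlMr // mulrC -normcM; apply: le_lt_trans.
suff -> : k * ((k * (w' - w))^-1 * (G (z + k * w') - G (z + k * w)) - D) =
    (w' - w)^-1 * (G (z + k * w') - G (z + k * w)) - k * D by [].
by rewrite mulrBr mulrA invfM mulrA mulfV // mul1r.
Qed.

Lemma is_derive_real_estimate (f : R -> R) (x D : R) : is_derive x 1 f D ->
  forall e : R, 0 < e -> exists2 r : R, 0 < r &
    forall h, `|h| < r -> `|f (x + h) - f x - D * h| <= e * `|h|.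
Proof.
move=> df e e0.
have /cvgrPdist_lt lim : h^-1 *: (f (h *: 1 + x) - f x) @[h --> 0^'] --> D.
  by case: df => df <-; exact: df.
have /nbhs_ballP[r /= r0 rP] := lim _ e0.
exists r => // h hr; have [->|h0] := eqVneq h 0.
  by rewrite addr0 subrr mulr0 subrr normr0 mulr0.
have := rP h; rewrite /ball /= sub0r normrN => /(_ hr h0).
rewrite /GRing.scale /= mulr1 [h + x]addrC distrC => /ltW.
have -> : f (x + h) - f x - D * h = (h^-1 * (f (x + h) - f x) - D) * h.
  by rewrite mulrBl mulrAC mulVf // mul1r.
by rewrite normrM => le; rewrite ler_wpM2r.
Qed.

End complex_derivative.

(** * Exponential and cosine *)

Section complex_exponential.
Context {R : realType}.
Implicit Types (x y : R) (z w k : R[i]).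

Definition cexp z : R[i] :=
  (expR (Re z) * cos (Im z)) +i* (expR (Re z) * sin (Im z)).

Lemma cexpD z w : cexp (z + w) = cexp z * cexp w.
Proof.
case: z w => x y [u v]; rewrite /cexp /= expRD cosD sinD.
by congr (_ +i* _); ring.
Qed.

Lemma cexp0 : cexp 0 = 1.
Proof. by rewrite /cexp /= expR0 cos0 sin0 mulr1 mulr0. Qed.

Lemma cexp_real x : cexp x%:C = (expR x)%:C.
Proof. by rewrite /cexp /= cos0 sin0 mulr1 mulr0. Qed.

Lemma normc_cexp z : normc (cexp z) = expR (Re z).
Proof.
rewrite /cexp /normc !exprMn -mulrDr cos2Dsin2 mulr1 sqrtr_sqr.
by rewrite gtr0_norm // expR_gt0.
Qed.

Lemma cexp_neq0 z : cexp z != 0.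
Proof. by rewrite -normc_gt0 normc_cexp expR_gt0. Qed.

(** It reduces to the real derivatives at 0 through e^x cos y - 1 - x = (e^x - 1 - x) + e^x (cos y -
    1) and e^x sin y - y = e^x (sin y - y) + (e^x - 1) y. *)
Lemma is_derive_cexp0 : is_derive (0 : R[i]) 1 cexp 1.
Proof.
apply: is_derive_estimate => e e0.
(* The four error terms below are at most 1, 3, 3 and 2 times d n, where n is the modulus: 9 d n in
   all. *)
pose d := Num.min 1 (e / 16).
have d0 : 0 < d by rewrite lt_min ltr01 divr_gt0.
have d1 : d <= 1 by rewrite ge_min lexx.
have de : d <= e / 16 by rewrite ge_min lexx orbT.
clearbody d.
have [r1 r10 h1] := is_derive_real_estimate (is_derive_expR (0 : R)) d0.
have [r2 r20 h2] := is_derive_real_estimate (is_derive_cos (0 : R)) d0.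
have [r3 r30 h3] := is_derive_real_estimate (is_derive_sin (0 : R)) d0.
exists (Num.min d (Num.min r1 (Num.min r2 r3))).
  by rewrite !lt_min d0 r10 r20 r30.
move=> [x y]; rewrite !lt_min => /and4P[nd n1 n2 n3].
have xn := @normc_normRe _ (x +i* y); have yn := @normc_normIm _ (x +i* y).
rewrite /= -/(normc (x +i* y)) in xn yn.
set n := normc (x +i* y) in nd n1 n2 n3 xn yn *.
have := h1 x (le_lt_trans xn n1); have := h2 y (le_lt_trans yn n2).
have := h3 y (le_lt_trans yn n3).
rewrite !add0r expR0 cos0 sin0 oppr0 mul0r !subr0 !mul1r.
rewrite addr0 => hs hc hx; rewrite cexp0.
have -> : cexp (x +i* y) - 1 - (x +i* y) =
    (expR x * cos y - 1 - x) +i* (expR x * sin y - 0 - y) by [].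
rewrite subr0.
have x1 : `|x| <= d by exact/ltW/(le_lt_trans xn).
have ex1 : `|expR x - 1| <= 2 * d.
  have -> : expR x - 1 = (expR x - 1 - x) + x by ring.
  apply: le_trans (ler_normD _ _) _.
  have : d * `|x| <= 1 * d by apply: ler_pM => //; exact: ltW.
  lra.
have ex : `|expR x| <= 3.
  have -> : expR x = (expR x - 1) + 1 by ring.
  by apply: le_trans (ler_normD _ _) _; rewrite normr1; lra.
apply: le_trans (normc_le_ReIm _) _; rewrite /=.
have -> : expR x * cos y - 1 - x = (expR x - 1 - x) + expR x * (cos y - 1).
  by ring.
have -> : expR x * sin y - y = expR x * (sin y - y) + (expR x - 1) * y by ring.
have n0 : 0 <= n by exact: normc_ge0.
have dx : d * `|x| <= d * n by rewrite ler_wpM2l // ltW.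
have dy : d * `|y| <= d * n by rewrite ler_wpM2l // ltW.
have b1 : `|expR x * (cos y - 1)| <= 3 * (d * n).
  by rewrite normrM; apply: ler_pM => //; exact: le_trans hc dy.
have b2 : `|expR x * (sin y - y)| <= 3 * (d * n).
  by rewrite normrM; apply: ler_pM => //; exact: le_trans hs dy.
have b3 : `|(expR x - 1) * y| <= 2 * d * n.
  by rewrite normrM; apply: ler_pM.
have b4 := ler_normD (expR x - 1 - x) (expR x * (cos y - 1)).
have b5 := ler_normD (expR x * (sin y - y)) ((expR x - 1) * y).
have pn : 0 <= d * n by rewrite mulr_ge0 // ltW.
have : d * n <= e / 16 * n by rewrite ler_wpM2r.
move: (d * n) (e * n) pn b1 b2 dx (mulrA 2 d n) b3 (mulrAC e n 16^-1) =>
  p q pn b1 b2 dx <- b3 <- h.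
lra.
Qed.

(** The addition formula transports the derivative at 0 to z. The case k = 0 is included: k will be
    the real parameter [c]. *)
Lemma is_derive_cexpM k z :
  is_derive z 1 (fun w => cexp (k * w)) (k * cexp (k * z)).
Proof.
apply: is_derive_estimate => e e0.
(* |k| + 1 instead of |k| keeps the quotients meaningful when k = 0. *)
pose M := normc (cexp (k * z)) * (normc k + 1).
have k1 : 0 < normc k + 1 by rewrite ltr_wpDl ?normc_ge0.
have M0 : 0 < M by rewrite mulr_gt0 // normc_gt0 cexp_neq0.
have /is_derive_cvg/cvgcP lim := is_derive_cexp0.
have [r r0 rP] := (dnbhs_normcP _ _).1 (lim _ (divr_gt0 e0 M0)).
exists (r / (normc k + 1)); first by rewrite divr_gt0.
move=> h hr; rewrite mulrDr cexpD.
have -> : cexp (k * z) * cexp (k * h) - cexp (k * z) - k * cexp (k * z) * h =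
    cexp (k * z) * (cexp (k * h) - 1 - k * h) by ring.
have [->|kh] := eqVneq (k * h) 0.
  by rewrite cexp0 subrr subr0 mulr0 normc0 mulr_ge0 ?normc_ge0 // ltW.
have khr : normc (k * h - 0) < r.
  rewrite subr0 normcM.
  have := hr; rewrite ltr_pdivlMr // mulrC; apply: le_lt_trans.
  by rewrite ler_wpM2r ?normc_ge0 // lerDl.
have := rP _ khr kh; rewrite !subr0 cexp0 => /ltW bnd.
have -> : cexp (k * h) - 1 - k * h =
    ((k * h)^-1 * (cexp (k * h) - 1) - 1) * (k * h).
  by rewrite mulrBl mulrAC mulVf // !mul1r.
rewrite !normcM.
apply: le_trans (_ : normc (cexp (k * z)) *
    (e / M * ((normc k + 1) * normc h)) <= _).
  rewrite ler_wpM2l ?normc_ge0 //; apply: ler_pM => //.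
  - exact: normc_ge0.
  - by rewrite mulr_ge0 ?normc_ge0.
  - by rewrite ler_wpM2r ?normc_ge0 // lerDl.
rewrite le_eqVlt; apply/orP; left; apply/eqP.
have n1 : normc (cexp (k * z)) != 0 by rewrite normc_eq0 cexp_neq0.
have n2 : normc k + 1 != 0 by rewrite gt_eqF.
by rewrite /M; field; rewrite ?n1 ?n2.
Qed.

Lemma is_derive_cexp z : is_derive z 1 cexp (cexp z).
Proof.
have := is_derive_cexpM 1 z; rewrite !mul1r.
by under eq_fun do rewrite mul1r.
Qed.

End complex_exponential.

(** * The cosine of pi w / 2: zeros, derivative and modulus *)

Section quarter_cosine.
Context {R : realType}.
Implicit Types (x y t : R) (z w : R[i]) (n : nat).

(* [cos (pi w / 2)], whose zeros are the odd integers *)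
Definition qcos w : R[i] :=
  2^-1 * (cexp ('i * (pi / 2)%:C * w) + cexp (- ('i * (pi / 2)%:C) * w)).

Lemma qcosE x y : let e := expR (pi / 2 * y) in
  qcos (x +i* y) =
  ((e + e^-1) / 2 * cos (pi / 2 * x)) +i* ((e^-1 - e) / 2 * sin (pi / 2 * x)).
Proof.
move=> e; rewrite /qcos.
have -> : 'i * (pi / 2)%:C * (x +i* y) = (- (pi / 2 * y)) +i* (pi / 2 * x).
  by simpc.
have -> : - ('i * (pi / 2)%:C) * (x +i* y) = (pi / 2 * y) +i* - (pi / 2 * x).
  by simpc.
have -> : 2^-1 = (2^-1 : R)%:C by rewrite fmorphV rmorph_nat.
rewrite /cexp /= cosN sinN expRN -/e; simpc.
by congr (_ +i* _); ring.
Qed.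

Lemma qcosN w : qcos (- w) = qcos w.
Proof. by rewrite /qcos !mulrN !mulNr opprK addrC. Qed.

Lemma qcos0 : qcos 0 = 1.
Proof. by rewrite /qcos !mulr0 cexp0 -[1 + 1](natrD _ 1 1) mulVf ?pnatr_eq0. Qed.

(** This is |cos (a + i b)|^2 = cos^2 a + sinh^2 b. The location of the zeros and the lower bound on
    the contour both follow from it by real arguments. *)
Lemma normc_qcos_sqr x y : let e := expR (pi / 2 * y) in
  normc (qcos (x +i* y)) ^+ 2 = cos (pi / 2 * x) ^+ 2 + ((e - e^-1) / 2) ^+ 2.
Proof.
move=> e; rewrite qcosE -/e /normc sqr_sqrtr; last by rewrite addr_ge0 ?sqr_ge0.
have := cos2Dsin2 (pi / 2 * x); have : e != 0 by rewrite gt_eqF // expR_gt0.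
move: (cos _) (sin _) => c s e0 cs.
rewrite [((e^-1 - e) / 2 * s) ^+ 2]exprMn.
have -> : s ^+ 2 = 1 - c ^+ 2 by rewrite -cs addrC addKr.
by field.
Qed.

Definition qcos_deriv w : R[i] :=
  2^-1 * ('i * (pi / 2)%:C *  cexp ('i * (pi / 2)%:C * w)
          + - ('i * (pi / 2)%:C) * cexp (- ('i * (pi / 2)%:C) * w)).

Lemma is_derive_qcos w : is_derive w 1 qcos (qcos_deriv w).
Proof.
have d1 := is_derive_cexpM ('i * (pi / 2)%:C) w.
have d2 := is_derive_cexpM (- ('i * (pi / 2)%:C)) w.
have d3 := is_deriveD d1 d2.
have d := @is_deriveZ _ _ _ _ 2^-1 _ _ _ d3.
exact: d.
Qed.

Lemma qcos_deriv0 : qcos_deriv 0 = 0.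
Proof. by rewrite /qcos_deriv !mulr0 cexp0 !mulr1 addrN mulr0. Qed.

Lemma qcos_derivN w : qcos_deriv (- w) = - qcos_deriv w.
Proof.
rewrite /qcos_deriv; set k := 'i * _; rewrite !mulrN !mulNr opprK; ring.
Qed.

Lemma qcos_deriv_real x :
  qcos_deriv x%:C = (- (pi / 2) * sin (pi / 2 * x))%:C.
Proof.
rewrite /qcos_deriv.
have -> : 'i * (pi / 2)%:C * x%:C = 0 +i* (pi / 2 * x) by simpc.
have -> : - ('i * (pi / 2)%:C) * x%:C = 0 +i* - (pi / 2 * x) by simpc.
have -> : 2^-1 = (2^-1 : R)%:C by rewrite fmorphV rmorph_nat.
rewrite /cexp /= cosN sinN expR0; simpc.
by rewrite -complexr0; congr (_ +i* _); field.
Qed.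

Lemma cos_even n t : cos (pi / 2 * (n.*2%:R + t)) = (-1) ^+ n * cos (pi / 2 * t).
Proof.
elim: n => [|n IH]; first by rewrite add0r expr0 mul1r.
have -> : pi / 2 * (n.+1.*2%:R + t) = pi / 2 * (n.*2%:R + t) + pi.
  by rewrite doubleS -[in LHS]addn2 natrD; field.
by rewrite cosDpi IH exprS mulN1r mulNr.
Qed.

Lemma sin_odd n : sin (pi / 2 * (n.*2.+1%:R : R)) = (-1) ^+ n.
Proof.
elim: n => [|n IH]; first by rewrite mulr1 sin_pihalf.
have -> : pi / 2 * (n.+1.*2.+1%:R : R) = pi / 2 * n.*2.+1%:R + pi.
  by rewrite doubleS -[in LHS]addn3 -[n.*2.+1]addn1 !natrD; field.
by rewrite sinDpi IH exprS mulN1r.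
Qed.

Lemma cos_odd n : cos (pi / 2 * (n.*2.+1%:R : R)) = 0.
Proof. by rewrite -[n.*2.+1]addn1 natrD cos_even mulr1 cos_pihalf mulr0. Qed.

Lemma qcos_odd n : qcos (n.*2.+1%:R : R)%:C = 0.
Proof. by rewrite qcosE mulr0 expR0 invr1 cos_odd subrr !mul0r mulr0. Qed.

Lemma qcos_neq0 n x y t : x = n.*2%:R + t -> `|t| < 1 -> qcos (x +i* y) != 0.
Proof.
move=> -> t1; rewrite -normc_eq0 -sqrf_eq0 normc_qcos_sqr gt_eqF //.
apply: ltr_wpDr; first exact: sqr_ge0.
rewrite cos_even exprMn sqrr_sign mul1r exprn_gt0 // cos_gt0_pihalf //.
have p0 : 0 < pi / 2 :> R by rewrite divr_gt0 // pi_gt0.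
move: t1; rewrite ltr_norml => /andP[t1 t2].
have h1 : 0 < pi / 2 * (1 + t) by apply: mulr_gt0 => //; lra.
have h2 : 0 < pi / 2 * (1 - t) by apply: mulr_gt0 => //; lra.
by apply/andP; split; lra.
Qed.

Lemma qcos_neq0_Im x y : y != 0 -> qcos (x +i* y) != 0.
Proof.
move=> y0; rewrite -normc_eq0 -sqrf_eq0 normc_qcos_sqr gt_eqF //.
apply: ltr_wpDl; first exact: sqr_ge0.
rewrite lt_neqAle sqr_ge0 andbT eq_sym sqrf_eq0 mulf_neq0 ?invr_eq0 //.
rewrite subr_eq0; apply: contra y0 => /eqP ee.
have : expR (pi / 2 * y) ^+ 2 = expR 0.
  by rewrite expR0 expr2 {1}ee mulVf // gt_eqF // expR_gt0.
rewrite expr2 -expRD => /expR_inj /eqP.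
by rewrite -mulr2n mulrn_eq0 /= !mulf_eq0 invr_eq0 pnatr_eq0 orbF gt_eqF ?pi_gt0.
Qed.

(** This is the vertical strip gained on the right when the contour passes from n to n + 1; its only
    zero is 2n + 1. *)
Lemma qcos_neq0_cell n x y :
  n.*2%:R + 2^-1 <= x -> x <= n.*2%:R + 5 / 2 -> x +i* y != (n.*2.+1%:R)%:C ->
  qcos (x +i* y) != 0.
Proof.
move=> nx xn xp.
have [ltx|gtx|eqx] := ltgtP x (n.*2%:R + 1).
- by apply: (@qcos_neq0 n _ _ (x - n.*2%:R)); [ring|rewrite ltr_norml; lra].
- apply: (@qcos_neq0 n.+1 _ _ (x - n.*2%:R - 2)).
    by rewrite doubleS -[in RHS]addn2 natrD; ring.
  by rewrite ltr_norml; apply/andP; split; lra.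
have x1 : x = n.*2.+1%:R by rewrite eqx -addn1 natrD.
have y0 : y != 0 by apply: contraNneq xp => ->; rewrite x1.
exact: qcos_neq0_Im.
Qed.

End quarter_cosine.

(** * Boas' formula for entire functions of type pi / 2 *)

Section boas_formula.
Context {R : realType}.
Variable F : R[i] -> R[i].
Hypothesis dF : forall z, derivable F z 1.
Implicit Types (x y : R) (z w p : R[i]) (n k : nat).

Local Notation odd k := (k.*2.+1%:R : R).

Definition boas_kernel w : R[i] :=
  (F w * (qcos w)^-1 - F 0) * (w^-1 * w^-1).

Lemma derivable_boas_kernel w : w != 0 -> qcos w != 0 ->
  derivable boas_kernel w 1.
Proof.
move=> w0 qw.
have dinv : derivable (fun w : R[i] => w^-1) w 1.
  by apply: derivableV; [exact: w0|exact: derivable_id].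
apply: derivableM; last by apply: derivableM; exact: dinv.
apply: derivableB; last exact: derivable_cst.
apply: derivableM; first exact: dF.
by apply: derivableV; [exact: qw|case: (is_derive_qcos w)].
Qed.

(** Near 0 the product is the difference quotient of F / cos at 0, whose derivative there is F' 0
    because the cosine has value 1 and derivative 0. *)
Lemma residue_boas_kernel0 :
  (w - 0) * boas_kernel w @[w --> 0^'] --> 'D_1 F 0.
Proof.
have qd : is_derive (0 : R[i]) 1 (fun w => F w * (qcos w)^-1) ('D_1 F 0).
  have d1 : is_derive (0 : R[i]) 1 F ('D_1 F 0) by exact: derivableP.
  have d2 : is_derive (0 : R[i]) 1 (fun w => (qcos w)^-1) 0.
    have q0 : (qcos (0 : R[i])) != 0 by rewrite qcos0 oner_eq0.
    have d := is_derive_qcos (0 : R[i]).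
    split; first by apply: derivableV => //; case: d.
    rewrite deriveV //.
    by case: d => _ ->; rewrite qcos_deriv0 scaler0.
  apply: is_derive_eq (is_deriveM d1 d2) _.
  by rewrite qcos0 invr1 scaler0 add0r /GRing.scale /= mul1r.
move/is_derive_cvg: qd; rewrite qcos0 invr1 mulr1; apply: cvg_trans.
apply: near_eq_cvg; apply/dnbhs_normcP; exists 1 => // w _ w0.
by rewrite !subr0 /boas_kernel [RHS]mulrCA [w * (_ * _)]mulrA mulfV // mul1r mulrC.
Qed.

(** The product is (F w (w - p) / cos (pi w / 2) - F 0 (w - p)) / w^2. As the cosine vanishes at p,
    the first quotient is F w over a difference quotient, and the term with F 0 tends to 0. *)
Lemma residue_boas_kernel p : p != 0 -> qcos p = 0 -> qcos_deriv p != 0 ->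
  (w - p) * boas_kernel w @[w --> p^'] --> F p / (qcos_deriv p * p ^+ 2).
Proof.
move=> p0 qp dq0.
have /is_derive_cvg := is_derive_qcos p; rewrite qp => dq.
have q1 : ((w - p)^-1 * (qcos w - 0))^-1 @[w --> p^'] --> (qcos_deriv p)^-1.
  exact: cvgV.
have i1 : w^-1 @[w --> p^'] --> p^-1 by apply: cvgV; [exact: p0|exact: cvg_id_dnbhs].
have f1 : F w @[w --> p^'] --> F p by exact: (cvg_dnbhs_continuous (@dF p)).
have s1 : (w - p) @[w --> p^'] --> p - p.
  by apply: cvgB; [exact: cvg_id_dnbhs|exact: cvg_cst].
have lim : (F w * ((w - p)^-1 * (qcos w - 0))^-1 - F 0 * (w - p)) *
    (w^-1 * w^-1) @[w --> p^'] -->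
    (F p / qcos_deriv p - F 0 * (p - p)) * (p^-1 * p^-1).
  apply: cvgM; last by apply: cvgM; exact: i1.
  apply: cvgB; first by apply: cvgM; [exact: f1|exact: q1].
  by apply: cvgM; [exact: cvg_cst|exact: s1].
have -> : F p / (qcos_deriv p * p ^+ 2) =
    (F p / qcos_deriv p - F 0 * (p - p)) * (p^-1 * p^-1).
  by rewrite subrr mulr0 subr0 expr2 !invfM !mulrA.
apply: cvg_trans lim; apply: near_eq_cvg.
apply/dnbhs_normcP; exists 1 => // w _ wp /=.
by rewrite /boas_kernel subr0 invfM invrK [RHS]mulrA; congr (_ * _); ring.
Qed.

(** The residues at - (2k + 1) and 2k + 1, taken together because the contour is symmetric. *)
Definition boas_residue k : R[i] :=
  (2 / pi * (-1) ^+ k / odd k ^+ 2)%:C * (F (- (odd k)%:C) - F (odd k)%:C).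

Lemma odd_gt0 k : 0 < odd k. Proof. by rewrite ltr0n. Qed.

Lemma residue_boas_kernel_odd k :
  (w - (odd k)%:C) * boas_kernel w @[w --> ((odd k)%:C)^'] -->
  - (2 / pi * (-1) ^+ k / odd k ^+ 2)%:C * F (odd k)%:C.
Proof.
have p0 := @pi_gt0 R.
have o0 := odd_gt0 k.
have q0 : qcos_deriv (odd k)%:C = (- (pi / 2) * (-1) ^+ k)%:C.
  by rewrite qcos_deriv_real sin_odd.
have n0 : (- (pi / 2) * (-1) ^+ k : R) != 0.
  by rewrite mulf_neq0 ?signr_eq0 // oppr_eq0 gt_eqF // divr_gt0.
have -> : - (2 / pi * (-1) ^+ k / odd k ^+ 2)%:C * F (odd k)%:C =
    F (odd k)%:C / (qcos_deriv (odd k)%:C * (odd k)%:C ^+ 2).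
  have -> : (qcos_deriv (odd k)%:C * (odd k)%:C ^+ 2)^-1 =
      ((- (pi / 2) * (-1) ^+ k * odd k ^+ 2)^-1)%:C.
    by rewrite q0 fmorphV !rmorphM !rmorphXn.
  rewrite mulrC -rmorphN; congr (_ * _%:C).
  have sI : ((-1) ^+ k)^-1 = (-1) ^+ k :> R := invr_sign _ _.
  have sn : (-1) ^+ k != 0 :> R by rewrite signr_eq0.
  have pn : pi != 0 :> R by rewrite gt_eqF.
  have on : odd k != 0 by rewrite gt_eqF.
  rewrite -{1}sI; move: (pi : R) (odd k) ((-1) ^+ k) pn on sn {n0 q0 o0 p0 sI}.
  by move=> t o s tn on sn; field; rewrite ?tn ?on ?sn.
apply: residue_boas_kernel.
- by rewrite fmorph_eq0 gt_eqF.
- exact: qcos_odd.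
- by rewrite q0 fmorph_eq0.
Qed.

Lemma residue_boas_kernel_oddN k :
  (w - - (odd k)%:C) * boas_kernel w @[w --> (- (odd k)%:C)^'] -->
  (2 / pi * (-1) ^+ k / odd k ^+ 2)%:C * F (- (odd k)%:C).
Proof.
have p0 := @pi_gt0 R.
have o0 := odd_gt0 k.
have q0 : qcos_deriv (- (odd k)%:C) = (pi / 2 * (-1) ^+ k)%:C.
  by rewrite qcos_derivN qcos_deriv_real sin_odd -rmorphN mulNr opprK.
have n0 : (pi / 2 * (-1) ^+ k : R) != 0.
  by rewrite mulf_neq0 ?signr_eq0 // gt_eqF // divr_gt0.
have -> : (2 / pi * (-1) ^+ k / odd k ^+ 2)%:C * F (- (odd k)%:C) =
    F (- (odd k)%:C) / (qcos_deriv (- (odd k)%:C) * (- (odd k)%:C) ^+ 2).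
  have -> : (qcos_deriv (- (odd k)%:C) * (- (odd k)%:C) ^+ 2)^-1 =
      ((pi / 2 * (-1) ^+ k * odd k ^+ 2)^-1)%:C.
    by rewrite q0 sqrrN fmorphV !rmorphM !rmorphXn.
  rewrite mulrC; congr (_ * _%:C).
  have sI : ((-1) ^+ k)^-1 = (-1) ^+ k :> R := invr_sign _ _.
  have sn : (-1) ^+ k != 0 :> R by rewrite signr_eq0.
  have pn : pi != 0 :> R by rewrite gt_eqF.
  have on : odd k != 0 by rewrite gt_eqF.
  rewrite -{1}sI; move: (pi : R) (odd k) ((-1) ^+ k) pn on sn {n0 q0 o0 p0 sI}.
  by move=> t o s tn on sn; field; rewrite ?tn ?on ?sn.
apply: residue_boas_kernel.
- by rewrite oppr_eq0 fmorph_eq0 gt_eqF.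
- by rewrite qcosN qcos_odd.
- by rewrite q0 fmorph_eq0.
Qed.

(** By induction on n: widening the rectangle adds two vertical strips of width 2 with one simple
    pole each. The half-height Y is independent of n, so that it stays fixed during the induction
    and the square is recovered at the end. *)
Lemma rect_integral_boas_kernel n Y : 0 < Y ->
  rect_integral boas_kernel (- (n.*2%:R + 2^-1)) (n.*2%:R + 2^-1) (- Y) Y
  = (2 * pi)%:C * 'i * ('D_1 F 0 + \sum_(0 <= k < n) boas_residue k).
Proof.
move=> Y0; elim: n => [|n IH].
  rewrite big_nil addr0 add0r.
  have Re0 : Re (0 : R[i]) = 0 by [].
  have Im0 : Im (0 : R[i]) = 0 by [].
  apply: (@residue_simple_pole _ _ 0); [rewrite ?Re0 ?Im0; lra..| |].
    move=> x y /andP[x1 x2] _ w0; apply: derivable_boas_kernel => //.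
    apply: (@qcos_neq0 _ 0 _ _ x); first by rewrite add0r.
    by rewrite ltr_norml; apply/andP; split; lra.
  exact: residue_boas_kernel0.
rewrite big_nat_recr //= addrA mulrDr -IH.
set a := n.*2%:R + 2^-1.
have -> : n.+1.*2%:R + 2^-1 = a + 2 :> R.
  by rewrite doubleS -[in LHS]addn2 natrD /a; ring.
have a0 : 0 < a by rewrite /a ltr_wpDl.
have a1 : a + 1 / 2 = odd n by rewrite /a -[n.*2.+1]addn1 natrD; field.
have cellp x y : a <= x -> x <= a + 2 -> x +i* y != (odd n)%:C ->
    derivable boas_kernel (x +i* y) 1.
  move=> x1 x2 xp; apply: derivable_boas_kernel.
    rewrite eq_complex /= negb_and gt_eqF //; lra.
  by apply: qcos_neq0_cell xp => //; rewrite /a in x1 x2; lra.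
have celln x y : - (a + 2) <= x -> x <= - a -> x +i* y != - (odd n)%:C ->
    derivable boas_kernel (x +i* y) 1.
  move=> x1 x2 xp; apply: derivable_boas_kernel.
    rewrite eq_complex /= negb_and lt_eqF //; lra.
  rewrite -qcosN; apply: (@qcos_neq0_cell _ n); rewrite -/a.
  - by rewrite /a in x2; lra.
  - by rewrite /a in x1; lra.
  - have -> : (- x) +i* (- y) = - (x +i* y) by [].
    by rewrite eqr_oppLR.
have vp x : a <= x -> x <= a + 2 -> x != odd n ->
    vseg_continuous boas_kernel x (- Y) Y.
  move=> x1 x2 xn y _; apply: derivable_continuous; apply: cellp => //.
  by rewrite eq_complex /= negb_and xn.
have vn x : - (a + 2) <= x -> x <= - a -> x != - odd n ->
    vseg_continuous boas_kernel x (- Y) Y.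
  move=> x1 x2 xn y _; apply: derivable_continuous; apply: celln => //.
  by rewrite eq_complex /= negb_and xn.
have hh x1 x2 y : y != 0 -> hseg_continuous boas_kernel x1 x2 y.
  move=> y0 x _; apply: derivable_continuous; apply: derivable_boas_kernel.
    by rewrite eq_complex /= negb_and y0 orbT.
  exact: qcos_neq0_Im.
rewrite (@rect_integral_splitx _ (- a)) //; last 4 first.
- by lra.
- by lra.
- split; [apply: hh; lra|apply: hh; lra|apply: vn|apply: vp]; lra.
- by apply: vn; lra.
rewrite (@rect_integral_splitx _ a _ (- a)) //; last 4 first.
- by lra.
- by lra.
- split; [apply: hh; lra|apply: hh; lra|apply: vn|apply: vp]; lra.
- by apply: vp; lra.
rewrite (@residue_simple_pole _ _ (- (odd n)%:C)
  ((2 / pi * (-1) ^+ n / odd n ^+ 2)%:C * F (- (odd n)%:C)) (- (a + 2)));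
  last 6 first.
- by rewrite /=; lra.
- by rewrite /=; lra.
- by rewrite /=; lra.
- by rewrite /=; lra.
- by move=> x y /andP[? ?] _; exact: celln.
- exact: residue_boas_kernel_oddN.
rewrite (@residue_simple_pole _ _ ((odd n)%:C)
  (- (2 / pi * (-1) ^+ n / odd n ^+ 2)%:C * F (odd n)%:C) a);
  last 6 first.
- by rewrite /=; lra.
- by rewrite /=; lra.
- by rewrite /=; lra.
- by rewrite /=; lra.
- by move=> x y /andP[? ?] _; exact: cellp.
- exact: residue_boas_kernel_odd.
by rewrite /boas_residue; ring.
Qed.

Variable C : R.
Hypothesis F_bound : forall x y,
  normc (F (x +i* y)) <= C * expR (pi / 2 * `|y|).

(** On the vertical sides cos^2 = 1/2, and 9 (1/2 + sinh^2) is 9/4 times the sum of the squares of e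
    and 1/e. On the horizontal sides |y| >= 2 because n > 0, so e >= 3 and 1/e <= 1, and already 3
    sinh >= e. *)
Lemma le_exp_normc_qcos n x y : (0 < n)%N ->
  `|x| = n.*2%:R + 2^-1 \/ `|y| = n.*2%:R + 2^-1 ->
  expR (pi / 2 * `|y|) <= 3 * normc (qcos (x +i* y)).
Proof.
move=> n0 frame; set e := expR _.
have e0 : 0 < e by exact: expR_gt0.
have p2 := @pi_ge2 R.
have sqrE : normc (qcos (x +i* y)) ^+ 2 =
    cos (pi / 2 * x) ^+ 2 + ((e - e^-1) / 2) ^+ 2.
  rewrite normc_qcos_sqr /e; have [y0|y0] := leP 0 y; first by rewrite ger0_norm.
  rewrite (ltr0_norm y0) mulrN expRN invrK; congr (_ + _).
  by rewrite -sqrrN -mulNr opprB.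
have r0 : 0 <= 3 * normc (qcos (x +i* y)) by rewrite mulr_ge0 ?normc_ge0.
rewrite -ler_sqr ?nnegrE ?(ltW e0) ?r0 // exprMn sqrE.
have ee : e * e^-1 = 1 by rewrite mulfV // gt_eqF.
have f0 : 0 < e^-1 by rewrite invr_gt0.
move: (e^-1) ee f0 => f ef f0.
case: frame => [xa|ya].
  have -> : cos (pi / 2 * x) ^+ 2 = 2^-1.
    have -> : cos (pi / 2 * x) = cos (pi / 2 * `|x|).
      have [x0|x0] := leP 0 x; first by rewrite ger0_norm.
      by rewrite ltr0_norm // mulrN cosN.
    rewrite xa cos_even exprMn sqrr_sign mul1r.
    (* cos^2 (pi / 4) = 1/2 follows from cos (pi / 2) = 0 and cos^2 + sin^2 = 1. *)
    have := cosD (pi / 2 * 2^-1 : R) (pi / 2 * 2^-1).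
    have -> : pi / 2 * 2^-1 + pi / 2 * 2^-1 = pi / 2 :> R by field.
    rewrite cos_pihalf; have := cos2Dsin2 (pi / 2 * 2^-1 : R).
    by rewrite -!expr2; lra.
  have : 0 <= e ^+ 2 by exact: sqr_ge0.
  have : 0 <= f ^+ 2 by exact: sqr_ge0.
  have -> : ((e - f) / 2) ^+ 2 = (e ^+ 2 - 2 * (e * f) + f ^+ 2) / 4 by field.
  rewrite ef; lra.
have a2 : 2 <= `|y|.
  rewrite ya; apply: (@le_trans _ _ n.*2%:R); last by rewrite lerDl.
  by rewrite ler_nat -[2%N]/(1.*2) leq_double.
have e3 : 3 <= e.
  apply: le_trans (expR_ge1Dx _).
  have : 1 * 2 <= pi / 2 * `|y| by apply: ler_pM => //; lra.
  lra.
have f1 : f <= 1.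
  have : 0 <= (e - 1) * f by apply: mulr_ge0; lra.
  by rewrite mulrBl ef mul1r; lra.
have h : e <= 3 * ((e - f) / 2) by lra.
apply: le_trans (_ : (3 * ((e - f) / 2)) ^+ 2 <= _).
  by rewrite ler_sqr // nnegrE; lra.
by rewrite exprMn ler_wpM2l ?sqr_ge0 // lerDr sqr_ge0.
Qed.

Lemma C_ge0 : 0 <= C.
Proof.
have := F_bound 0 0; rewrite normr0 mulr0 expR0 mulr1.
exact: le_trans (normc_ge0 _).
Qed.

(** 4 C is 3 C, from F over the cosine, plus C, from F 0. *)
Lemma boas_kernel_bound n x y : (0 < n)%N ->
  `|x| = n.*2%:R + 2^-1 \/ `|y| = n.*2%:R + 2^-1 ->
  normc (boas_kernel (x +i* y)) <= 4 * C / (n.*2%:R + 2^-1) ^+ 2.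
Proof.
move=> n0 frame; have C0 := C_ge0.
have eq := le_exp_normc_qcos n0 frame.
set a := n.*2%:R + 2^-1 in frame *.
have a0 : 0 < a by rewrite /a ltr_wpDl.
clearbody a.
have aw : a <= normc (x +i* y).
  case: frame => <-.
    exact: (@normc_normRe _ (x +i* y)).
  exact: (@normc_normIm _ (x +i* y)).
set w := x +i* y in eq aw *.
have e0 := expR_gt0 (pi / 2 * `|y|).
have q0 : 0 < normc (qcos w) by lra.
rewrite /boas_kernel normcM; apply: ler_pM; rewrite ?normc_ge0 //.
  apply: le_trans (le_normcD _ _) _; rewrite normcN normcM normcV.
  have F0 : normc (F 0) <= C.
    by have := F_bound 0 0; rewrite normr0 mulr0 expR0 mulr1.
  have : normc (F w) / normc (qcos w) <= 3 * C.
    rewrite ler_pdivrMr //; apply: le_trans (F_bound x y) _.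
    by rewrite [3 * C]mulrC -(mulrA C) ler_wpM2l.
  lra.
rewrite normcM normcV expr2 invfM.
by apply: ler_pM; rewrite ?invr_ge0 ?normc_ge0 // lef_pV2 // posrE; lra.
Qed.

(** The contour integral is at most 4 (4 C / a^2) (4 a) = 64 C / a with a = 2n + 1/2; dividing by 2
    pi >= 4 and using a >= n gives the bound. *)
Lemma boas_partial_bound n : (0 < n)%N ->
  normc ('D_1 F 0 + \sum_(0 <= k < n) boas_residue k) <= 16 * C / n%:R.
Proof.
move=> n0; have C0 := C_ge0.
have p2 := @pi_ge2 R.
have bnd := boas_kernel_bound n0.
set a := n.*2%:R + 2^-1 in bnd.
have a0 : 0 < a by rewrite /a ltr_wpDl.
have na : n%:R <= a.
  by rewrite /a -addnn natrD -addrA lerDl addr_ge0.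
have nn : 0 < n%:R :> R by rewrite ltr0n.
have := rect_integral_boas_kernel n a0; rewrite -/a => resE.
have qcos_a x y : `|x| = a \/ `|y| = a -> x +i* y != 0 /\ qcos (x +i* y) != 0.
  move=> frame; split.
    rewrite eq_complex /= negb_and -!(normr_eq0 x) -!(normr_eq0 y).
    by case: frame => ->; rewrite (gt_eqF a0) ?orbT.
  have := le_exp_normc_qcos n0 frame.
  rewrite -normc_gt0; have := expR_gt0 (pi / 2 * `|y|); lra.
have der x y : `|x| = a \/ `|y| = a -> {for x +i* y, continuous boas_kernel}.
  move=> /qcos_a[w0 qw]; apply: derivable_continuous.
  exact: derivable_boas_kernel.
have aN : `|- a| = a by rewrite normrN gtr0_norm.
have aP : `|a| = a by rewrite gtr0_norm.
have : normc (rect_integral boas_kernel (- a) a (- a) a) <=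
    4 * (4 * C / a ^+ 2) * ((a - - a) + (a - - a)).
  apply: le_normc_rect_integral; [lra|lra| |..].
  - by split=> t _; apply: der; [right|right|left|left].
  - by move=> t _; apply: bnd; right.
  - by move=> t _; apply: bnd; right.
  - by move=> t _; apply: bnd; left.
  - by move=> t _; apply: bnd; left.
have a_neq0 : a != 0 by rewrite gt_eqF.
have -> : 4 * (4 * C / a ^+ 2) * ((a - - a) + (a - - a)) = 64 * C / a.
  by move: (a) a_neq0 => b bn; field.
rewrite resE normcM normcM normcR.
have -> : normc ('i : R[i]) = 1 by rewrite /= expr0n expr1n /= add0r sqrtr1.
rewrite mulr1 gtr0_norm; last by lra.
set N := normc _ => h.
have N0 : 0 <= N by exact: normc_ge0.
have h4 : 4 * N <= 64 * C / a.
  by apply: le_trans h; rewrite ler_wpM2r //; lra.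
have h5 : N <= 16 * C / a by lra.
apply: le_trans h5 _.
by rewrite ler_wpM2l ?lef_pV2 ?posrE // mulr_ge0.
Qed.

End boas_formula.

(** * Series indexed by the integers *)

Section integer_series.
Context {R : realType}.
Implicit Types (u : nat -> R[i]) (t : int -> R[i]) (M : R).

Local Notation weight k := (((k.*2.+1)%:R : R) ^- 2).

(** The right-hand side is 2 / ((k + 1) (k + 2)); equality at k = 0 forces the constant 2. *)
Lemma weight_telescope k : weight k <= 2 / k.+1%:R - 2 / k.+2%:R.
Proof.
have k0 : 0 <= k%:R :> R by exact: ler0n.
have -> : k.*2.+1%:R = 2 * k%:R + 1 :> R by rewrite -addn1 natrD -mul2n natrM.
have -> : k.+1%:R = k%:R + 1 :> R by rewrite -addn1 natrD.
have -> : k.+2%:R = k%:R + 2 :> R by rewrite -addn2 natrD.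
move: (k%:R : R) k0 => x x0.
have -> : 2 / (x + 1) - 2 / (x + 2) = 2 / ((x + 1) * (x + 2)).
  by field; rewrite !gt_eqF //; lra.
have x2 : 0 <= x * x by exact: mulr_ge0.
have p1 : 0 < (2 * x + 1) ^+ 2 by rewrite exprn_gt0 //; lra.
have p2 : 0 < (x + 1) * (x + 2) by rewrite mulr_gt0 //; lra.
rewrite -[leLHS]mul1r ler_pdivrMr // mulrAC ler_pdivlMr //.
by rewrite expr2; lra.
Qed.

Lemma sum_weight_le n : \sum_(0 <= k < n) weight k <= 2.
Proof.
suff : \sum_(0 <= k < n) weight k <= 2 - 2 / n.+1%:R.
  by move=> /le_trans; apply; rewrite gerBl divr_ge0.
elim: n => [|n IH]; first by rewrite big_nil divr1 subrr.
rewrite big_nat_recr //=; apply: le_trans (lerD IH (weight_telescope n)) _.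
by rewrite addrA subrK.
Qed.

(** The rate depends on [M] alone, which later makes the convergence uniform in the parameters of
    the terms. *)
Lemma series_limit M u : (forall k, normc (u k) <= M * weight k) ->
  exists l, forall n,
    normc (\sum_(0 <= k < n) u k - l) <= 4 * M / n.+1%:R.
Proof.
move=> uM; pose d n : R := 2 * M / n.+1%:R.
pose S n := \sum_(0 <= k < n) u k.
have M0 : 0 <= M.
  have := le_trans (normc_ge0 _) (uM 0%N).
  by rewrite expr1n invr1 mulr1.
(* [P (S n) -/+ d n] are the ends of nested intervals *)
have step (P : {additive R[i] -> R}) : (forall z, `|P z| <= normc z) ->
    exists x, forall n, P (S n) - d n <= x <= P (S n) + d n.
  move=> Pn.
  have PS n : P (S n.+1) = P (S n) + P (u n).
    by rewrite /S big_nat_recr //= raddfD.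
  have un n : `|P (u n)| <= d n - d n.+1.
    apply: le_trans (Pn _) _; apply: le_trans (uM n) _.
    have -> : d n - d n.+1 = M * (2 / n.+1%:R - 2 / n.+2%:R).
      by rewrite /d; ring.
    by rewrite ler_wpM2l // weight_telescope.
  apply: nested_intervals => n.
  - by have := un n; rewrite PS ler_norml => /andP[? ?]; lra.
  - by have := un n; rewrite PS ler_norml => /andP[? ?]; lra.
  - have : 0 <= d n by rewrite /d divr_ge0 // mulr_ge0.
    lra.
have [x xP] := step (@complex.Re R) (@normc_normRe R).
have [y yP] := step (@complex.Im R) (@normc_normIm R).
exists (x +i* y) => n; apply: le_trans (normc_le_ReIm _) _.
have -> : 4 * M / n.+1%:R = d n + d n by rewrite /d; ring.
have := xP n; have := yP n; rewrite -/(S n) !raddfB /=.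
move=> /andP[? ?] /andP[? ?].
by apply: lerD; rewrite ler_norml; apply/andP; split; lra.
Qed.

Lemma zpartial_limit M t :
  (forall k : nat, normc (t k%:Z) <= M * weight k) ->
  (forall k : nat, normc (t (- (k.+1)%:Z)) <= M * weight k) ->
  exists l, forall N,
    normc (zpartial t N - l) <= 4 * M / N.1.+1%:R + 4 * M / N.2.+1%:R.
Proof.
move=> /series_limit[l2 h2] /series_limit[l1 h1].
exists (l1 + l2) => -[n1 n2] /=; rewrite /zpartial opprD addrACA.
by apply: le_trans (le_normcD _ _) _; apply: lerD; [exact: h1|exact: h2].
Qed.

Lemma near_small_tails M (e : R) : 0 < e ->
  \forall N \near filter_prod \oo \oo,
    4 * M / N.1.+1%:R + 4 * M / N.2.+1%:R < e.
Proof.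
move=> e0; pose k := Num.truncn (8 * `|M| / e).
have kP n : (k <= n)%N -> 4 * M / n.+1%:R < e / 2.
  move=> kn; rewrite ltr_pdivrMr ?ltr0n //.
  have : 8 * `|M| / e < n.+1%:R.
    by apply: lt_le_trans (truncnS_gt _) _; rewrite ler_nat.
  rewrite ltr_pdivrMr // => h.
  by have := ler_norm M; rewrite mulrAC [n.+1%:R * e]mulrC in h *; lra.
exists ([set n | (k <= n)%N], [set n | (k <= n)%N]).
  by split; exists k.
move=> [n1 n2] [h1 h2]; rewrite [ltRHS](splitr e).
by apply: ltrD; exact: kP.
Qed.

Lemma zpartial_zsum M t :
  (forall k : nat, normc (t k%:Z) <= M * weight k) ->
  (forall k : nat, normc (t (- (k.+1)%:Z)) <= M * weight k) ->
  forall N,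
    normc (zpartial t N - zsum t) <= 4 * M / N.1.+1%:R + 4 * M / N.2.+1%:R.
Proof.
move=> t1 t2; have [l lP] := zpartial_limit t1 t2.
suff -> : zsum t = l by [].
have lim : zpartial t N @[N --> filter_prod \oo \oo] --> l.
  apply/cvgcP => e e0; apply: filterS (near_small_tails M e0) => N.
  exact: le_lt_trans (lP N).
rewrite /zsum; apply: cvg_lim lim; exact: norm_hausdorff.
Qed.

(** The integers split into the naturals and the numbers - (k + 1), and the weights bound both
    halves alike. *)
Lemma summable_int M t :
  (forall k : nat, normc (t k%:Z) <= M * weight k) ->
  (forall k : nat, normc (t (- (k.+1)%:Z)) <= M * weight k) ->
  summable [set: int] (fun k => (normc (t k))%:E).
Proof.
move=> t1 t2.
have M0 : 0 <= M.
  by have := le_trans (normc_ge0 _) (t1 0%N); rewrite expr1n invr1 mulr1.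
have bound (v : nat -> int) :
    (forall k, normc (t (v k)) <= M * weight k) -> injective v ->
    (\esum_(i in range v) `|(normc (t i))%:E| < +oo)%E.
  move=> vM vI; rewrite esum_image; last by move=> ? ? _ _; exact: vI.
  rewrite -nneseries_esumT; last by move=> n; exact: abse_ge0.
  apply: (@le_lt_trans _ _ (M * 2)%:E); last by rewrite ltry.
  apply: lime_le; first by apply: is_cvg_nneseries => n _ _; exact: abse_ge0.
  apply: nearW => n; under eq_bigr do rewrite /= ger0_norm ?normc_ge0 //.
  rewrite sumEFin lee_fin; apply: le_trans (ler_sum _ (fun k _ => vM k)) _.
  by rewrite -mulr_sumr ler_wpM2l // sum_weight_le.
rewrite /summable (esumID (range Posz)) //.
rewrite !setTI; apply: lte_add_pinfty; first by apply: bound => // ? ? [].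
have -> : ~` range Posz = range (fun k : nat => - (k.+1)%:Z).
  apply/seteqP; split => [[k|k] /= h|_ [k _ <-] [m _]] //.
    by case: h; exists k.
  by exists k => //; rewrite NegzE.
by apply: bound => // ? ? /oppr_inj[].
Qed.

End integer_series.

(** * From the polar half-plane to the complex plane *)

Section Mellin_Bernstein_functions.
Context {R : realType}.
Variables (c T Cf : R) (f : R * R -> R[i]).
Hypothesis T0 : 0 < T.
Hypothesis f_analytic : polar_analytic f.
Hypothesis f_bound : forall r theta, polarH (r, theta) ->
  r `^ c * normc (f (r, theta)) <= Cf * expR (T * `|theta|).
Implicit Types (z w : R[i]).

(** The polar half-plane is the universal cover of the punctured plane. This map identifies the
    complex plane with it, and turns [polar] into the exponential. *)
Definition log_polar z : R * R := (expR (Re z), Im z).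

Lemma polar_log_polar z : polar (log_polar z) = cexp z.
Proof. by rewrite /polar /log_polar /cexp /=; simpc. Qed.

Lemma log_polar_inj : injective log_polar.
Proof. by move=> [x y] [x' y'] [/expR_inj /= -> /= ->]. Qed.

(** Continuity alone would not keep the values off the limit point; injectivity does. *)
Lemma log_polar_cvg z : log_polar w @[w --> z^'] --> (log_polar z)^'.
Proof.
have cid : w @[w --> z^'] --> z by exact: cvg_id_dnbhs.
have cre : expR (Re w) @[w --> z^'] --> expR (Re z).
  have cre : Re w @[w --> z^'] --> Re z by apply: cvg_Re; exact: cid.
  by move: cre; apply: continuous_cvg; exact: continuous_expR.
have cim : Im w @[w --> z^'] --> Im z by apply: cvg_Im; exact: cid.
have cphi : log_polar w @[w --> z^'] --> log_polar z.
  exact: cvg_pair cre cim.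
move=> A hA.
have /dnbhs_normcP[r r0 rP] : \forall w \near z^',
  log_polar w != log_polar z -> A (log_polar w) := cphi _ hA.
suff : \forall w \near z^', A (log_polar w) by [].
apply/dnbhs_normcP; exists r => // w wr wz; apply: rP => //.
by rewrite (inj_eq log_polar_inj).
Qed.

(** Chain rule in quotient form: the polar quotient times the difference quotient of the
    exponential. *)
Lemma is_derive_log_polar z : is_derive z 1 (fun w => f (log_polar w))
  (Dpol f (log_polar z) * cexp z).
Proof.
have H0 : polarH (log_polar z) by exact: expR_gt0.
have := f_analytic H0 => fcv.
have lim1 : polar_quotient f (log_polar z) (log_polar w) @[w --> z^'] -->
    Dpol f (log_polar z).
  exact: cvg_comp (@log_polar_cvg z) fcv.
have /is_derive_cvg lim2 := is_derive_cexp z.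
have lim3 : polar_quotient f (log_polar z) (log_polar w) *
    ((w - z)^-1 * (cexp w - cexp z)) @[w --> z^'] -->
    Dpol f (log_polar z) * cexp z.
  by apply: cvgM; [exact: lim1|exact: lim2].
apply/is_derive_cvg; apply: cvg_trans lim3; apply: near_eq_cvg.
(* The quotient of the exponential tends to a nonzero limit, so cexp w differs from cexp z near z
   and the denominator cancels. *)
have ce0 : 0 < normc (cexp z) by rewrite normc_gt0 cexp_neq0.
have /cvgcP /(_ _ ce0) := lim2.
apply: filterS => w h.
have ne : cexp w - cexp z != 0.
  apply/eqP => e0; move: h.
  by rewrite e0 mulr0 sub0r normcN ltxx.
rewrite /polar_quotient !polar_log_polar.
by rewrite mulrCA -[(f _ - f _) / _ * _]mulrA mulVf // mulr1.
Qed.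

Definition lifted z : R[i] := cexp (c%:C * z) * f (log_polar z).

(** The two summands of the Mellin derivative are the two terms of the product rule. *)
Lemma is_derive_lifted z : is_derive z 1 lifted
  (cexp (c%:C * z) * polar_Mellin_derivative c f (log_polar z)).
Proof.
have d1 := is_derive_cexpM c%:C z.
have d2 := is_derive_log_polar z.
apply: is_derive_eq (is_deriveM d1 d2) _.
rewrite /polar_Mellin_derivative polar_log_polar /GRing.scale /=; ring.
Qed.

Lemma lifted_bound z : normc (lifted z) <= Cf * expR (T * `|Im z|).
Proof.
have := @f_bound (expR (Re z)) (Im z) (expR_gt0 _).
rewrite -expRM /lifted normcM normc_cexp [Re z * c]mulrC.
have -> // : Re (c%:C * z) = c * Re z.
by case: z => x y; simpc.
Qed.

Section at_a_point.
Variable (x : R * R).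
Hypothesis x0 : polarH x.

Let z0 : R[i] := ln x.1 +i* x.2.
(** This scale changes the type T into T h0 = pi / 2, and sends 2 j + 1 to (j + 1/2) pi / T. *)
Let h0 : R := pi / (2 * T).
Let F w := lifted (z0 + h0%:C * w).

Lemma log_polarK : log_polar z0 = x.
Proof. by rewrite /log_polar /= lnK ?posrE //; case: (x). Qed.

Lemma h0_gt0 : 0 < h0.
Proof. by rewrite divr_gt0 ?pi_gt0 // mulr_gt0. Qed.

Lemma is_derive_rescaled w : is_derive w 1 F
  (h0%:C * (cexp (c%:C * (z0 + h0%:C * w)) *
    polar_Mellin_derivative c f (log_polar (z0 + h0%:C * w)))).
Proof.
apply: is_derive_affine; last exact: is_derive_lifted.
by rewrite fmorph_eq0 gt_eqF // h0_gt0.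
Qed.

(** The factor e^(T |x.2|) is the cost of moving the base point off the real axis. *)
Lemma rescaled_bound u v : normc (F (u +i* v)) <=
  Cf * expR (T * `|x.2|) * expR (pi / 2 * `|v|).
Proof.
apply: le_trans (lifted_bound _) _.
have C0 : 0 <= Cf.
  have := lifted_bound 0; have := normc_ge0 (lifted 0).
  by rewrite [Im 0]/= normr0 mulr0 expR0 mulr1; exact: le_trans.
rewrite -mulrA -expRD ler_wpM2l // ler_expR.
have -> : Im (z0 + h0%:C * (u +i* v)) = x.2 + h0 * v by rewrite /z0; simpc.
apply: le_trans (_ : T * (`|x.2| + `|h0 * v|) <= _).
  by rewrite ler_wpM2l ?ler_normD // ltW.
rewrite mulrDr lerD2l normrM (gtr0_norm h0_gt0) mulrA.
suff -> : T * h0 = pi / 2 by [].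
by rewrite /h0; move: (pi : R) => t; field; rewrite gt_eqF.
Qed.

(** The factor e^(c z0) is common to all terms and to the derivative at the point, so it cancels in
    the formula. *)
Lemma rescaled_odd (j : int) :
  ((-1) ^ j / (2 * j%:~R + 1) ^+ 2)%:C * F (2 * j%:~R + 1)%:C =
  cexp (c%:C * z0) * boas_term c T f x j.
Proof.
set s := (-1) ^ j / _.
have E : z0 + h0%:C * (2 * j%:~R + 1)%:C =
    (ln x.1 + (j%:~R + 2^-1) * pi / T) +i* x.2.
  rewrite /z0; simpc; congr (_ +i* _).
  rewrite /h0; move: (pi : R) => t; field; rewrite gt_eqF //.
rewrite /boas_term /F /lifted E /log_polar /=.
rewrite expRD lnK ?posrE // -/s.
have -> : c%:C * ((ln x.1 + (j%:~R + 2^-1) * pi / T) +i* x.2) =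
    c%:C * z0 + ((j%:~R + 2^-1) * pi * c / T)%:C.
  by rewrite /z0; simpc; congr (_ +i* _); ring.
rewrite cexpD cexp_real [(s * _)%:C]rmorphM /=; ring.
Qed.

(** The exponential in the term changes r^c into y^c, where y is the radius of the sample, so the
    growth condition applies at that sample and only the weight remains. *)
Lemma boas_term_bound (j : int) :
  normc ((x.1 `^ c)%:C * boas_term c T f x j) <=
  Cf * expR (T * `|x.2|) * (2 * j%:~R + 1) ^- 2.
Proof.
rewrite /boas_term.
set y := x.1 * expR _.
have y0 : 0 < y by rewrite mulr_gt0 // expR_gt0.
have yc : y `^ c = x.1 `^ c * expR ((j%:~R + 2^-1) * pi * c / T).
  rewrite powRM ?(ltW x0) ?expR_ge0 // -expRM; congr (_ * expR _); ring.
rewrite mulrA -rmorphM normcM normcR.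
rewrite mulrCA -yc !normrM normfV normrX (gtr0_norm (powR_gt0 _ y0)).
have -> : `|(-1) ^ j| = 1 :> R by case: (j) => n; rewrite /exprz ?normfV normrX normrN1 expr1n ?invr1.
rewrite mul1r -normrX ger0_norm ?sqr_ge0 // -(mulrA _^-1) [leLHS]mulrC.
apply: ler_wpM2r; first by rewrite invr_ge0 sqr_ge0.
exact: f_bound.
Qed.

End at_a_point.

End Mellin_Bernstein_functions.

(** * The formula, absolute summability and uniform convergence *)

Section boas_theorem.
Context {R : realType}.
Variables (c T Cf : R) (f : R * R -> R[i]).
Hypothesis T0 : 0 < T.
Hypothesis f_analytic : polar_analytic f.
Hypothesis f_bound : forall r theta, polarH (r, theta) ->
  r `^ c * normc (f (r, theta)) <= Cf * expR (T * `|theta|).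

Lemma oddz_nat k : 2 * (k%:Z)%:~R + 1 = k.*2.+1%:R :> R.
Proof. by rewrite -pmulrn -[k.*2.+1]addn1 natrD -mul2n natrM. Qed.

(** The pole - (2k + 1) carries the index - (k + 1), so the symmetric sums over poles are the sums
    over -n <= j < n. *)
Lemma oddz_negnat k : 2 * (- (k.+1)%:Z)%:~R + 1 = - k.*2.+1%:R :> R.
Proof.
rewrite rmorphN /= -pmulrn -(addn1 k.*2) -(addn1 k) !natrD -mul2n natrM; ring.
Qed.

Lemma boas_term_bound_nat x k : polarH x ->
  normc ((x.1 `^ c)%:C * boas_term c T f x k%:Z) <=
  Cf * expR (T * `|x.2|) * (k.*2.+1)%:R ^- 2.
Proof. by move=> x0; rewrite -oddz_nat; exact: boas_term_bound. Qed.

Lemma boas_term_bound_negnat x k : polarH x ->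
  normc ((x.1 `^ c)%:C * boas_term c T f x (- (k.+1)%:Z)) <=
  Cf * expR (T * `|x.2|) * (k.*2.+1)%:R ^- 2.
Proof.
by move=> x0; rewrite -[_%:R ^+ 2]sqrrN -oddz_negnat; exact: boas_term_bound.
Qed.

(** The contour argument computes only the diagonal sums; once the two-ended limit exists, they
    determine it. *)
Lemma cvg_zpartial_diag (t : int -> R[i]) (l : R[i]) :
  zpartial t N @[N --> filter_prod \oo \oo] --> l ->
  zpartial t (n, n) @[n --> \oo] --> l.
Proof.
move=> lim P /lim [[A B] [/= hA hB] AB].
by apply: filterS (filterI hA hB) => n ?; exact: (AB (n, n)).
Qed.

Lemma boas_formula x : polarH x ->
  polar_Mellin_derivative c f x
  = (4 * T / pi ^+ 2)%:C * zsum (boas_term c T f x).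
Proof.
move=> x0; set t := boas_term c T f x; set Th := polar_Mellin_derivative c f x.
have p0 := @pi_gt0 R.
pose z0 : R[i] := ln x.1 +i* x.2; pose h0 : R := pi / (2 * T).
pose F (w : R[i]) : R[i] := lifted c f (z0 + h0%:C * w).
pose K := Cf * expR (T * `|x.2|).
pose E := cexp (c%:C * z0).
have dF (w : R[i]) : is_derive w 1 F (h0%:C * (cexp (c%:C * (z0 + h0%:C * w)) *
    polar_Mellin_derivative c f (log_polar (z0 + h0%:C * w)))).
  exact: is_derive_rescaled.
have dF1 w : derivable F w 1 by case: (dF w).
have F_bound u v : normc (F (u +i* v)) <= K * expR (pi / 2 * `|v|).
  exact: rescaled_bound.
have DF0 : 'D_1 F 0 = h0%:C * (E * Th).
  case: (dF 0) => _ ->; rewrite mulr0 addr0 -/z0 -/E.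
  by rewrite /z0 log_polarK.
have resE k : boas_residue F k =
    - (2 / pi)%:C * E * (t (- (k.+1)%:Z) + t k%:Z).
  have odd_val (j : int) : ((-1) ^ j / (2 * j%:~R + 1) ^+ 2)%:C *
      F (2 * j%:~R + 1)%:C = E * t j by exact: rescaled_odd.
  have h1 := odd_val k%:Z; have h2 := odd_val (- (k.+1)%:Z).
  rewrite oddz_nat in h1; rewrite oddz_negnat in h2.
  rewrite -mulrA mulrDr -h1 -h2 /boas_residue -/(F _) -/(F _).
  rewrite sqrrN.
  (* The index - (k + 1) has parity opposite to k; this absorbs the sign between the two values of F
     in [boas_residue]. *)
  have -> : (-1) ^ (- (k.+1)%:Z) = - (-1) ^+ k :> R.
    by rewrite -exprz_inv invrN1 -exprnP exprS mulN1r.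
  rewrite -exprnP rmorphN.
  have -> : (2 / pi * (-1) ^+ k / k.*2.+1%:R ^+ 2)%:C =
     (2 / pi)%:C * ((-1) ^+ k / k.*2.+1%:R ^+ 2)%:C :> R[i].
    by rewrite -rmorphM mulrA.
  rewrite [(- (-1) ^+ k / _)%:C](_ : _ = - ((-1) ^+ k / k.*2.+1%:R ^+ 2)%:C).
    by ring.
  by rewrite mulNr rmorphN.
have partial n : (0 < n)%N ->
    normc (h0%:C * (E * Th) - (2 / pi)%:C * E * zpartial t (n, n))
    <= 16 * K / n%:R.
  move=> n0; have := boas_partial_bound dF1 F_bound n0.
  rewrite DF0; under eq_bigr do rewrite resE.
  by rewrite -mulr_sumr big_split /= !mulNr.
have r0 : 0 < x.1 `^ c by exact: powR_gt0.
have tE k : t k = ((x.1 `^ c)^-1)%:C * ((x.1 `^ c)%:C * t k).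
  by rewrite mulrA -rmorphM mulVf ?mul1r // gt_eqF.
have zlim : zpartial t N @[N --> filter_prod \oo \oo] --> zsum t.
  (* At a fixed point, the bounds for the weighted terms pass to the terms themselves on division by
     r^c. *)
  have tb M k : normc ((x.1 `^ c)%:C * t k) <= K * M ->
      normc (t k) <= K / x.1 `^ c * M.
    move=> h; rewrite tE normcM normcR gtr0_norm ?invr_gt0 //.
    rewrite [K / _]mulrC -mulrA; apply: ler_wpM2l h.
    by rewrite invr_ge0 ltW.
  have h1 k := tb _ _ (boas_term_bound_nat k x0).
  have h2 k := tb _ _ (boas_term_bound_negnat k x0).
  apply/cvgcP => e e0.
  apply: filterS (near_small_tails (K / x.1 `^ c) e0) => N.
  exact/le_lt_trans/(zpartial_zsum h1 h2).
have dlim := cvg_zpartial_diag zlim.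
have lim1 : h0%:C * (E * Th) - (2 / pi)%:C * E * zpartial t (n, n)
    @[n --> \oo] --> h0%:C * (E * Th) - (2 / pi)%:C * E * zsum t.
  apply: cvgB; first exact: cvg_cst.
  by apply: cvgM; [exact: cvg_cst|exact: dlim].
have lim0 : h0%:C * (E * Th) - (2 / pi)%:C * E * zpartial t (n, n)
    @[n --> \oo] --> (0 : R[i]).
  apply/cvgcP => e e0.
  exists (Num.truncn (16 * K / e)).+1 => // n /= hn.
  have n0 : (0 < n)%N by exact: leq_trans hn.
  rewrite subr0; apply: le_lt_trans (partial n n0) _.
  rewrite ltr_pdivrMr ?ltr0n // [e * _]mulrC -ltr_pdivrMr //.
  by apply: lt_le_trans (truncnS_gt _) _; rewrite ler_nat.
have eqn : h0%:C * (E * Th) = (2 / pi)%:C * E * zsum t.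
  apply/eqP; rewrite -subr_eq0; apply/eqP.
  transitivity (lim ((h0%:C * (E * Th) - (2 / pi)%:C * E * zpartial t (n, n))
      @[n --> \oo])).
    by apply/esym; apply: cvg_lim lim1; exact: norm_hausdorff.
  by apply: cvg_lim lim0; exact: norm_hausdorff.
have E0 : E != 0 by exact: cexp_neq0.
have h00 : h0%:C != 0 :> R[i].
  by rewrite fmorph_eq0 gt_eqF // divr_gt0 // mulr_gt0.
apply: (mulfI E0); apply: (mulfI h00); rewrite eqn.
(* The coefficient of the theorem appears here, as 2 / pi divided by h0. *)
have -> : (2 / pi)%:C = h0%:C * (4 * T / pi ^+ 2)%:C :> R[i].
  rewrite -rmorphM /h0; congr (_%:C).
  by move: (pi : R) p0 => q q0; field; rewrite !gt_eqF.
by rewrite /=; ring.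
Qed.

Lemma boas_summable x : polarH x ->
  summable [set: int]
    (fun k : int => (normc ((x.1 `^ c)%:C * boas_term c T f x k))%:E).
Proof.
move=> x0; apply: (@summable_int _ (Cf * expR (T * `|x.2|))) => k.
  exact: boas_term_bound_nat.
exact: boas_term_bound_negnat.
Qed.

(** On the strip |theta| <= |a| + |b|, so one constant bounds all the weighted terms, and the
    explicit rate of [zpartial_zsum] holds at every point of the strip. *)
Lemma boas_uniform (a b : R) :
  {uniform strip a b,
    (fun (N : nat * nat) (x : R * R) =>
       zpartial (fun k : int => (x.1 `^ c)%:C * boas_term c T f x k) N)
      @ filter_prod \oo \oo
    --> (fun x : R * R =>
       zsum (fun k : int => (x.1 `^ c)%:C * boas_term c T f x k))}.
Proof.
pose M := Cf * expR (T * (`|a| + `|b|)).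
have C0 : 0 <= Cf.
  have h1 : polarH ((1, 0) : R * R) by rewrite /polarH /= ltr01.
  have := f_bound h1; rewrite normr0 mulr0 expR0 mulr1; apply: le_trans.
  by rewrite mulr_ge0 ?powR_ge0 ?normc_ge0.
have stripM x : strip a b x -> Cf * expR (T * `|x.2|) <= M.
  move=> [_ /andP[ax xb]]; rewrite /M ler_wpM2l // ler_expR ler_wpM2l ?(ltW T0) //.
  have := ler_norm (- a); have := ler_norm b; rewrite normrN => ? ?.
  have := normr_ge0 a; have := normr_ge0 b => ? ?.
  by rewrite ler_norml; apply/andP; split; lra.
move=> P /uniform_nbhs[U [entU UP]].
have [[e e'] /= /[dup] e0] : exists2 e : R[i], 0 < e &
    [set xy | ball xy.1 e xy.2] `<=` U.
  by have := entU; rewrite -entourage_ballE => -[e e0 eU]; exists e.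
rewrite ltcE /= => /andP[/eqP e'0 e00] eU.
apply: filterS (near_small_tails M e00) => N hN.
apply: UP => x sx; apply: eU.
have x0 : polarH x by case: sx.
rewrite /ball /= norm_normc e'0 complexr0 ltcR normcB.
apply: le_lt_trans (zpartial_zsum (M := M) _ _ _) hN => k.
  apply: le_trans (boas_term_bound_nat k x0) _.
  by rewrite ler_wpM2r ?stripM // invr_ge0 exprn_ge0.
apply: le_trans (boas_term_bound_negnat k x0) _.
by rewrite ler_wpM2r ?stripM // invr_ge0 exprn_ge0.
Qed.

End boas_theorem.

Unset Implicit Arguments.

Theorem theorem6 (R : realType) (p : \bar R) (c T : R) (f : R * R -> R[i])
    (hp : (1 <= p)%E) (hT : 0 < T) (hf : Mellin_Bernstein p c T f) :
  [/\ forall x : R * R, polarH x ->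
        polar_Mellin_derivative c f x
        = (4 * T / pi ^+ 2)%:C * zsum (boas_term c T f x),
      forall x : R * R, polarH x ->
        summable [set: int]
          (fun k : int => (normc ((x.1 `^ c)%:C * boas_term c T f x k))%:E) &
      forall a b : R, a < b ->
        {uniform strip a b,
          (fun (N : nat * nat) (x : R * R) =>
             zpartial (fun k : int => (x.1 `^ c)%:C * boas_term c T f x k) N)
            @ filter_prod \oo \oo
          --> (fun x : R * R =>
             zsum (fun k : int => (x.1 `^ c)%:C * boas_term c T f x k))}].
Proof.
case: hf => f_analytic _ [Cf _ f_bound]; split.
- by move=> x x0; exact: (boas_formula hT f_analytic f_bound x0).
- by move=> x x0; exact: (boas_summable f_bound x0).
- by move=> a b _; exact: (boas_uniform hT f_bound).
Qed.
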